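(* The operad of transposed Poisson algebras is self dual, that is, it is isomorphic to its Koszul dual operad.
   Context: All vector spaces are over a field $K$ of characteristic zero. A transposed Poisson algebra is a triple $(L,\cdot,[\;,\;])$ where $L$ is a vector space, $(L,\cdot)$ is a (not necessarily unital) commutative associative algebra, $(L,[\;,\;])$ is a Lie algebra, and $2z\cdot[x,y]=[z\cdot x,y]+[x,z\cdot y]$ for all $x,y,z\in L$. The operad of transposed Poisson algebras is the binary quadratic symmetric operad $\mathcal{P}(E,R)=\mathcal{T}(E)/(R)$ whose space of generating binary operations is $E=K\mu\oplus K\nu$, with $\mu$ symmetric (trivial $S_2$-action) and $\nu$ skew-symmetric (sign $S_2$-action), and whose relations $R\subset\mathcal{T}(E)(3)$ are the $S_3$-submodule generated by the associativity of $\mu$, the Jacobi identity of $\nu$, and $2\mu(x,\nu(y,z))=\nu(\mu(x,y),z)+\nu(y,\mu(x,z))$. Here $\mathcal{T}(E)$ denotes the free operad on $E$. For a binary quadratic operad $\mathcal{P}(E,R)$ with $E$ finite dimensional, the Koszul dual operad is $\mathcal{P}(E^\vee,R^\perp)$, where $E^\vee=E^*\otimes\mathrm{sgn}$ and $R^\perp\subset\mathcal{T}(E^\vee)(3)$ is the annihilator of $R$ under the natural pairing $\mathcal{T}(E^\vee)(3)\otimes\mathcal{T}(E)(3)\to K$. Explicitly, writing for operations $\alpha,\beta$: $\alpha\circ_{\mathrm I}\beta=\alpha(\beta(x,y),z)$, $\alpha\circ_{\mathrm{II}}\beta=\alpha(\beta(y,z),x)$, $\alpha\circ_{\mathrm{III}}\beta=\alpha(\beta(z,x),y)$,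 the space $\mathcal{T}(E)(3)$ is the direct sum of three copies of $E\otimes E$ spanned by the $\alpha\circ_u\beta$ ($u=\mathrm{I},\mathrm{II},\mathrm{III}$), and the pairing is $\langle\alpha^*\circ_u\beta^*,\alpha\circ_v\beta\rangle=\delta_{u,v}\,\alpha^*(\alpha)\,\beta^*(\beta)$ for elements $\alpha^*,\beta^*\in E^\vee$ and $\alpha,\beta\in E$. *)

(* Defs.v *)
From HB Require Import structures.
From mathcomp Require Import all_boot all_order all_fingroup all_algebra.
From mathcomp Require Import boolp zify.

Set Implicit Arguments.
Unset Strict Implicit.
Unset Printing Implicit Defensive.

Import GRing.Theory.
Local Open Scope ring_scope.
Local Open Scope quotient_scope.

(** Arities are natural numbers and the n inputs of an operation of arity n
    are numbered by ['I_n], i.e. from 0.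

    - [op_act s f] is f with its variables relabelled so that the variable
      number k is plugged into the input number [s k] of f, i.e.
      (op_act s f)(x_0, .., x_(n-1)) = f(x_(s^-1 0), .., x_(s^-1 (n-1))).
      This is the usual right action of the symmetric group; it satisfies
      [op_act s (op_act t f) = op_act (s * t) f] because the product of
      permutations in MathComp is in diagrammatic order.

    - [op_comp e i f g] is the partial composition f o_i g, of arity
      m + n - 1.  The arity p of the result is a separate index, tied by the
      equation [e : m + n = p.+1], so that no transport along equalities of
      arities is needed in the axioms. *)

(** Position in f o_i g of the input j <> i of f, where g has n inputs; the
    input j of g is in position i + j. *)
Definition outer_pos (n i j : nat) : nat := if (j < i)%N then j else (j + n).-1.

(** r is the block permutation s o_i t. *)
Definition block_perm (m n p : nat) (i : 'I_m) (s : 'S_m) (t : 'S_n) (r : 'S_p) :=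
  (forall (j : 'I_m) (k : 'I_p), j != i -> k = outer_pos n i j :> nat ->
     r k = outer_pos n (s i) (s j) :> nat) /\
  (forall (j : 'I_n) (k : 'I_p), k = (i + j)%N :> nat ->
     r k = (s i + t j)%N :> nat).

Record operad (K : fieldType) := Operad {
  op_sort :> nat -> lmodType K;
  op_act : forall n, 'S_n -> op_sort n -> op_sort n;
  op_id : op_sort 1%N;
  op_comp : forall m n p, (m + n = p.+1)%N -> 'I_m ->
    op_sort m -> op_sort n -> op_sort p;
  op_act_linear : forall n (s : 'S_n), linear (op_act s);
  op_act1 : forall n (x : op_sort n), op_act 1%g x = x;
  op_actM : forall n (s t : 'S_n) (x : op_sort n),
    op_act s (op_act t x) = op_act (s * t)%g x;
  op_comp_linearl : forall m n p (e : (m + n = p.+1)%N) (i : 'I_m) (y : op_sort n),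
    linear (fun x => op_comp e i x y);
  op_comp_linearr : forall m n p (e : (m + n = p.+1)%N) (i : 'I_m) (x : op_sort m),
    linear (fun y => op_comp e i x y);
  op_comp1l : forall n (e : (1 + n = n.+1)%N) (i : 'I_1) (x : op_sort n),
    op_comp e i op_id x = x;
  op_comp1r : forall n (e : (n + 1 = n.+1)%N) (i : 'I_n) (x : op_sort n),
    op_comp e i x op_id = x;
  (* (x o_i y) o_(i+j) z = x o_i (y o_j z) *)
  op_comp_seq : forall l m n p q r
    (e1 : (l + m = p.+1)%N) (e2 : (p + n = r.+1)%N)
    (e3 : (m + n = q.+1)%N) (e4 : (l + q = r.+1)%N)
    (i : 'I_l) (j : 'I_m) (k : 'I_p)
    (x : op_sort l) (y : op_sort m) (z : op_sort n),
    k = (i + j)%N :> nat ->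
    op_comp e2 k (op_comp e1 i x y) z = op_comp e4 i x (op_comp e3 j y z);
  (* (x o_i y) o_(j-1+m) z = (x o_j z) o_i y  for i < j *)
  op_comp_par : forall l m n p q r
    (e1 : (l + m = p.+1)%N) (e2 : (p + n = r.+1)%N)
    (e3 : (l + n = q.+1)%N) (e4 : (q + m = r.+1)%N)
    (i j : 'I_l) (j' : 'I_p) (i' : 'I_q)
    (x : op_sort l) (y : op_sort m) (z : op_sort n),
    (i < j)%N -> j' = (j + m).-1 :> nat -> i' = i :> nat ->
    op_comp e2 j' (op_comp e1 i x y) z = op_comp e4 i' (op_comp e3 j x z) y;
  op_comp_act : forall m n p (e : (m + n = p.+1)%N) (i : 'I_m)
    (s : 'S_m) (t : 'S_n) (r : 'S_p) (x : op_sort m) (y : op_sort n),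
    block_perm i s t r ->
    op_comp e i (op_act s x) (op_act t y) = op_act r (op_comp e (s i) x y)
}.

Arguments op_act {K} _ {n} s x.
Arguments op_id {K} _.
Arguments op_comp {K} _ {m n p} e i x y.

(** Block permutations always exist, so [op_comp_act] covers all s and t. *)
Lemma block_perm_ex (m n p : nat) (e : (m + n = p.+1)%N) (i : 'I_m)
  (s : 'S_m) (t : 'S_n) : exists r : 'S_p, block_perm i s t r.
Proof.
pose Q (k v : 'I_p) :=
  (exists j : 'I_m, [/\ j != i, k = outer_pos n i j :> nat &
                       v = outer_pos n (s i) (s j) :> nat]) \/
  (exists j : 'I_n, k = (i + j)%N :> nat /\ v = (s i + t j)%N :> nat).
have neq (u : 'S_m) (j j' : 'I_m) : j != j' -> (u j : nat) <> u j'.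
  by move=> /eqP jj' ujj'; apply: jj'; apply: (@perm_inj _ u); apply: val_inj.
have exQ k : exists v, Q k v.
  have [ltk|gek] := ltnP k (i + n).
    have [lek|ltki] := leqP i k.
      have kn : (k - i < n)%N by lia.
      have vp : (s i + t (Ordinal kn) < p)%N.
        by have := ltn_ord (s i); have := ltn_ord (t (Ordinal kn)); lia.
      by exists (Ordinal vp); right; exists (Ordinal kn); split=> //=; lia.
    have km : (k < m)%N by have := ltn_ord i; lia.
    have ki : Ordinal km != i by rewrite -val_eqE /=; lia.
    have vp : (outer_pos n (s i) (s (Ordinal km)) < p)%N.
      have := neq s _ _ ki; have := ltn_ord (s i); have := ltn_ord (s (Ordinal km)).
      by rewrite /outer_pos; case: ifP => /=; lia.
    exists (Ordinal vp); left; exists (Ordinal km); split=> //=.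
    by rewrite /outer_pos /= ltki.
  have km : ((k - n).+1 < m)%N by have := ltn_ord k; lia.
  have ki : Ordinal km != i by rewrite -val_eqE /=; lia.
  have vp : (outer_pos n (s i) (s (Ordinal km)) < p)%N.
    have := neq s _ _ ki; have := ltn_ord (s i); have := ltn_ord (s (Ordinal km)).
    by rewrite /outer_pos; case: ifP => /=; lia.
  exists (Ordinal vp); left; exists (Ordinal km); split=> //=.
  by rewrite /outer_pos /=; case: ifP => /=; lia.
have outerI (u : 'S_m) (j j' : 'I_m) : j != i -> j' != i ->
    outer_pos n (u i) (u j) = outer_pos n (u i) (u j') -> j = j'.
  move=> /(neq u) ji /(neq u) j'i eqo; apply: (@perm_inj _ u); apply: val_inj.
  by move: eqo; rewrite /outer_pos; do 2!case: ifP => /=; lia.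
have outer_inner (u : 'S_m) (j : 'I_m) (a : 'I_n) : j != i ->
    outer_pos n (u i) (u j) <> (u i + a)%N.
  by move=> /(neq u) ji; have := ltn_ord a; rewrite /outer_pos; case: ifP => /=; lia.
have id1 (j : 'I_m) : outer_pos n i j = outer_pos n ((1%g : 'S_m) i) ((1%g : 'S_m) j).
  by rewrite !perm1.
have [f fQ] := boolp.choice exQ.
have f_inj : injective f.
  move=> k k' ff; apply: val_inj => /=.
  case: (fQ k) => [[j [ji -> vj]]|[j [-> vj]]];
  case: (fQ k') => [[j' [j'i -> vj']]|[j' [-> vj']]]; rewrite ff in vj.
  - by rewrite (outerI s j j') // -vj -vj'.
  - by case: (outer_inner s j (t j') ji); rewrite -vj -vj'.
  - by case: (outer_inner s j' (t j) j'i); rewrite -vj -vj'.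
  - have -> // : j = j'; apply: (@perm_inj _ t); apply: val_inj => /=.
    by apply: (@addnI (s i)); rewrite -vj -vj'.
exists (perm f_inj); split=> [j k ji kj|j k kj]; rewrite permE.
  case: (fQ k) => [[j' [j'i kj' ->]]|[j' [kj' _]]].
    by rewrite (outerI 1%g j j') // -!id1 -kj -kj'.
  by case: (outer_inner 1%g j j' ji); rewrite -id1 perm1 -kj -kj'.
case: (fQ k) => [[j' [j'i kj' _]]|[j' [kj' ->]]].
  by case: (outer_inner 1%g j' j j'i); rewrite -id1 perm1 -kj -kj'.
by have -> // : j = j'; apply: val_inj; apply: (@addnI i); rewrite -kj -kj'.
Qed.

Record operad_morphism (K : fieldType) (P Q : operad K)
    (f : forall n, P n -> Q n) : Prop := OperadMorphism {
  om_linear : forall n, linear (f n);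
  om_id : f 1%N (op_id P) = op_id Q;
  om_act : forall n (s : 'S_n) (x : P n), f n (op_act P s x) = op_act Q s (f n x);
  om_comp : forall m n p (e : (m + n = p.+1)%N) (i : 'I_m) (x : P m) (y : P n),
    f p (op_comp P e i x y) = op_comp Q e i (f m x) (f n y)
}.

Definition operad_isomorphic (K : fieldType) (P Q : operad K) : Prop :=
  exists f : forall n, P n -> Q n,
    operad_morphism f /\ forall n, bijective (f n).

(** A type with operations that satisfy the axioms of modules up to a
    congruence [pm_eq]. *)
Record premodule (K : fieldType) := Premodule {
  pm_sort : Type;
  pm0 : pm_sort;
  pmD : pm_sort -> pm_sort -> pm_sort;
  pmZ : K -> pm_sort -> pm_sort;
  pm_eq : pm_sort -> pm_sort -> Prop;
  pm_refl : forall x, pm_eq x x;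
  pm_sym : forall x y, pm_eq x y -> pm_eq y x;
  pm_trans : forall x y z, pm_eq x y -> pm_eq y z -> pm_eq x z;
  pm_eqD : forall x x' y y', pm_eq x x' -> pm_eq y y' -> pm_eq (pmD x y) (pmD x' y');
  pm_eqZ : forall a x x', pm_eq x x' -> pm_eq (pmZ a x) (pmZ a x');
  pm_addA : forall x y z, pm_eq (pmD x (pmD y z)) (pmD (pmD x y) z);
  pm_addC : forall x y, pm_eq (pmD x y) (pmD y x);
  pm_add0 : forall x, pm_eq (pmD pm0 x) x;
  pm_addN : forall x, pm_eq (pmD (pmZ (-1) x) x) pm0;
  pm_scaleA : forall a b x, pm_eq (pmZ a (pmZ b x)) (pmZ (a * b) x);
  pm_scale1 : forall x, pm_eq (pmZ 1 x) x;
  pm_scaleDr : forall a x y, pm_eq (pmZ a (pmD x y)) (pmD (pmZ a x) (pmZ a y));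
  pm_scaleDl : forall x a b, pm_eq (pmZ (a + b) x) (pmD (pmZ a x) (pmZ b x))
}.

Section QuotientModule.
Variables (K : fieldType) (M : premodule K).

Definition pm_eqb (x y : {classic pm_sort M}) : bool := `[< @pm_eq K M x y >].

Lemma pm_eqb_refl : reflexive pm_eqb.
Proof. by move=> x; apply/asboolP; apply: pm_refl. Qed.
Lemma pm_eqb_sym : symmetric pm_eqb.
Proof. by move=> x y; apply/asboolP/asboolP; apply: pm_sym. Qed.
Lemma pm_eqb_trans : transitive pm_eqb.
Proof. by move=> y x z /asboolP xy /asboolP yz; apply/asboolP; apply: pm_trans xy yz. Qed.

Canonical pm_equiv := EquivRel pm_eqb pm_eqb_refl pm_eqb_sym pm_eqb_trans.

Definition quot_mod := {eq_quot pm_equiv}.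
HB.instance Definition _ := Choice.on quot_mod.

Definition qpi (x : pm_sort M) : quot_mod := \pi_{eq_quot pm_equiv} (x : {classic pm_sort M}).
Definition qrepr (u : quot_mod) : pm_sort M := generic_quotient.repr (u : {eq_quot pm_equiv}).

Lemma qreprK u : qpi (qrepr u) = u. Proof. exact: reprK. Qed.
Lemma qpiP x y : qpi x = qpi y <-> @pm_eq K M x y.
Proof. by split=> [/eqmodP/asboolP|xy] //; apply/eqmodP/asboolP. Qed.
Lemma qreprP x : @pm_eq K M (qrepr (qpi x)) x.
Proof. by apply/qpiP; rewrite qreprK. Qed.
Lemma qpiW (A : quot_mod -> Prop) : (forall x, A (qpi x)) -> forall u, A u.
Proof. by move=> H u; rewrite -[u]qreprK. Qed.

Definition quot_add u v := qpi (@pmD K M (qrepr u) (qrepr v)).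
Definition quot_scale a u := qpi (@pmZ K M a (qrepr u)).

Lemma quot_addE x y : quot_add (qpi x) (qpi y) = qpi (pmD x y).
Proof. by apply/qpiP; apply: pm_eqD; apply: qreprP. Qed.
Lemma quot_scaleE a x : quot_scale a (qpi x) = qpi (pmZ a x).
Proof. by apply/qpiP; apply: pm_eqZ; apply: qreprP. Qed.

Lemma quot_addA : associative quot_add.
Proof.
by elim/qpiW=> x; elim/qpiW=> y; elim/qpiW=> z; rewrite !quot_addE; apply/qpiP/pm_addA.
Qed.
Lemma quot_addC : commutative quot_add.
Proof. by elim/qpiW=> x; elim/qpiW=> y; rewrite !quot_addE; apply/qpiP/pm_addC. Qed.
Lemma quot_add0 : left_id (qpi (pm0 M)) quot_add.
Proof. by elim/qpiW=> x; rewrite quot_addE; apply/qpiP/pm_add0. Qed.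
Lemma quot_addN : left_inverse (qpi (pm0 M)) (quot_scale (-1)) quot_add.
Proof. by elim/qpiW=> x; rewrite quot_scaleE quot_addE; apply/qpiP/pm_addN. Qed.

HB.instance Definition _ := @GRing.isZmodule.Build quot_mod
  (qpi (pm0 M)) (quot_scale (-1)) quot_add quot_addA quot_addC quot_add0 quot_addN.

Lemma quot_scaleA a b u : quot_scale a (quot_scale b u) = quot_scale (a * b) u.
Proof. by elim/qpiW: u => x; rewrite !quot_scaleE; apply/qpiP/pm_scaleA. Qed.
Lemma quot_scale1 : left_id 1 quot_scale.
Proof. by elim/qpiW=> x; rewrite quot_scaleE; apply/qpiP/pm_scale1. Qed.
Lemma quot_scaleDr : right_distributive quot_scale +%R.
Proof.
move=> a; elim/qpiW=> x; elim/qpiW=> y.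
rewrite [_ + _]quot_addE [RHS]/GRing.add/= !quot_scaleE quot_addE.
exact/qpiP/pm_scaleDr.
Qed.
Lemma quot_scaleDl u : {morph quot_scale^~ u : a b / a + b}.
Proof.
move=> a b; elim/qpiW: u => x.
by rewrite !quot_scaleE [RHS]quot_addE; apply/qpiP/pm_scaleDl.
Qed.

HB.instance Definition _ := @GRing.Zmodule_isLmodule.Build K quot_mod
  quot_scale quot_scaleA quot_scale1 quot_scaleDr quot_scaleDl.

Lemma qpiD x y : qpi x + qpi y = qpi (pmD x y). Proof. exact: quot_addE. Qed.
Lemma qpiZ a x : a *: qpi x = qpi (pmZ a x). Proof. exact: quot_scaleE. Qed.

End QuotientModule.

(** Finite-dimensional representations of the symmetric group S_2, with the
    same convention as [op_actM]. *)
Record binary_module (K : fieldType) := BinaryModule {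
  bm_sort :> vectType K;
  bm_act : 'S_2 -> 'End(bm_sort);
  bm_act1 : forall x, bm_act 1%g x = x;
  bm_actM : forall s t x, bm_act s (bm_act t x) = bm_act (s * t)%g x
}.

Arguments bm_act {K} _ s.

Section FreeOperad.
Variables (K : fieldType) (E : binary_module K).

Definition equivariant (P : operad K) (f : E -> P 2%N) : Prop :=
  linear f /\ forall s x, f (bm_act E s x) = op_act P s (f x).

(** Formal expressions in the operations of an operad and elements of E. *)
Inductive opterm : nat -> Type :=
| Tgen : E -> opterm 2
| Tid : opterm 1
| Tact n : 'S_n -> opterm n -> opterm n
| Tcomp m n p : (m + n = p.+1)%N -> 'I_m -> opterm m -> opterm n -> opterm p
| Tzero n : opterm n
| Tadd n : opterm n -> opterm n -> opterm n
| Tscale n : K -> opterm n -> opterm n.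

Fixpoint teval (P : operad K) (f : E -> P 2%N) n (t : opterm n) : P n :=
  match t in opterm n return P n with
  | Tgen x => f x
  | Tid => op_id P
  | Tact n s t => op_act P s (teval f t)
  | Tcomp m n p e i t u => op_comp P e i (teval f t) (teval f u)
  | Tzero n => 0
  | Tadd n t u => teval f t + teval f u
  | Tscale n a t => a *: teval f t
  end.

(** Two expressions are identified when the equality follows from the axioms
    of operads and the equivariance and linearity of the generators, i.e. when
    it holds in all operads. *)
Definition term_eq n (t u : opterm n) : Prop :=
  forall (P : operad K) (f : E -> P 2%N), equivariant f -> teval f t = teval f u.

Definition term_premodule (n : nat) : premodule K.
Proof.
apply: (@Premodule K (opterm n) (Tzero n) (@Tadd n) (@Tscale n) (@term_eq n)) => /=.
- by [].
- by move=> x y xy P f fE; rewrite xy.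
- by move=> x y z xy yz P f fE; rewrite xy ?yz.
- by move=> x x' y y' xx' yy' P f fE /=; rewrite xx' ?yy'.
- by move=> a x x' xx' P f fE /=; rewrite xx'.
- by move=> x y z P f fE /=; rewrite addrA.
- by move=> x y P f fE /=; rewrite addrC.
- by move=> x P f fE /=; rewrite add0r.
- by move=> x P f fE /=; rewrite scaleN1r addNr.
- by move=> a b x P f fE /=; rewrite scalerA.
- by move=> x P f fE /=; rewrite scale1r.
- by move=> a x y P f fE /=; rewrite scalerDr.
- by move=> x a b P f fE /=; rewrite scalerDl.
Defined.

Definition free_sort (n : nat) : lmodType K := quot_mod (term_premodule n).

Definition free_pi n (t : opterm n) : free_sort n := @qpi K (term_premodule n) t.
Definition free_repr n (x : free_sort n) : opterm n := @qrepr K (term_premodule n) x.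

Definition free_act n (s : 'S_n) (x : free_sort n) : free_sort n :=
  free_pi (Tact s (free_repr x)).
Definition free_comp m n p (e : (m + n = p.+1)%N) (i : 'I_m)
    (x : free_sort m) (y : free_sort n) : free_sort p :=
  free_pi (Tcomp e i (free_repr x) (free_repr y)).

Lemma free_piP n (t u : opterm n) : free_pi t = free_pi u <-> term_eq t u.
Proof. exact: (@qpiP K (term_premodule n)). Qed.
Lemma free_reprK n (x : free_sort n) : free_pi (free_repr x) = x.
Proof. exact: (@qreprK K (term_premodule n)). Qed.
Lemma free_reprP n (t : opterm n) : term_eq (free_repr (free_pi t)) t.
Proof. exact: (@qreprP K (term_premodule n)). Qed.
Lemma free_piW n (A : free_sort n -> Prop) :
  (forall t, A (free_pi t)) -> forall x, A x.
Proof. exact: (@qpiW K (term_premodule n)). Qed.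
Lemma free_piD n (t u : opterm n) : free_pi t + free_pi u = free_pi (Tadd t u).
Proof. exact: (@qpiD K (term_premodule n)). Qed.
Lemma free_piZ n a (t : opterm n) : a *: free_pi t = free_pi (Tscale a t).
Proof. exact: (@qpiZ K (term_premodule n)). Qed.

(** The value of an element of T(E) in the operad P. *)
Definition free_eval (P : operad K) (f : E -> P 2%N) n (x : free_sort n) : P n :=
  teval f (free_repr x).

Section FreeEval.
Variables (P : operad K) (f : E -> P 2%N) (fE : equivariant f).

Lemma free_eval_pi n (t : opterm n) : free_eval f (free_pi t) = teval f t.
Proof. exact: free_reprP. Qed.
Lemma free_evalD n (x y : free_sort n) :
  free_eval f (x + y) = free_eval f x + free_eval f y.
Proof.
by elim/free_piW: x => t; elim/free_piW: y => u; rewrite free_piD !free_eval_pi.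
Qed.
Lemma free_evalZ n a (x : free_sort n) :
  free_eval f (a *: x) = a *: free_eval f x.
Proof. by elim/free_piW: x => t; rewrite free_piZ !free_eval_pi. Qed.
Lemma free_eval_id : free_eval f (free_pi Tid) = op_id P.
Proof. exact: free_eval_pi. Qed.
Lemma free_eval_act n (s : 'S_n) (x : free_sort n) :
  free_eval f (free_act s x) = op_act P s (free_eval f x).
Proof. exact: free_eval_pi. Qed.
Lemma free_eval_comp m n p (e : (m + n = p.+1)%N) (i : 'I_m)
    (x : free_sort m) (y : free_sort n) :
  free_eval f (free_comp e i x y) = op_comp P e i (free_eval f x) (free_eval f y).
Proof. exact: free_eval_pi. Qed.

Definition free_evalE :=
  (free_eval_act, free_eval_comp, free_eval_id, free_evalD, free_evalZ).
End FreeEval.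

Lemma free_eval_inj n (x y : free_sort n) :
  (forall (P : operad K) (f : E -> P 2%N), equivariant f ->
     free_eval f x = free_eval f y) -> x = y.
Proof.
elim/free_piW: x => t; elim/free_piW: y => u tu; apply/free_piP=> P f fE.
by rewrite -!(free_eval_pi fE) tu.
Qed.

Definition free_operad : operad K.
Proof.
apply: (@Operad K free_sort free_act (free_pi Tid) free_comp).
- move=> n s a x y; apply: free_eval_inj => P f fE.
  by rewrite !(free_evalE fE) op_act_linear.
- by move=> n x; apply: free_eval_inj => P f fE; rewrite !(free_evalE fE) op_act1.
- by move=> n s t x; apply: free_eval_inj => P f fE; rewrite !(free_evalE fE) op_actM.
- move=> m n p e i y a x x'; apply: free_eval_inj => P f fE.
  by rewrite !(free_evalE fE) op_comp_linearl.
- move=> m n p e i x a y y'; apply: free_eval_inj => P f fE.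
  by rewrite !(free_evalE fE) op_comp_linearr.
- move=> n e i x; apply: free_eval_inj => P f fE.
  by rewrite !(free_evalE fE) op_comp1l.
- move=> n e i x; apply: free_eval_inj => P f fE.
  by rewrite !(free_evalE fE) op_comp1r.
- move=> l m n p q r e1 e2 e3 e4 i j k x y z kE; apply: free_eval_inj => P f fE.
  by rewrite !(free_evalE fE); apply: op_comp_seq.
- move=> l m n p q r e1 e2 e3 e4 i j j' i' x y z ij jE iE.
  apply: free_eval_inj => P f fE.
  by rewrite !(free_evalE fE); apply: op_comp_par ij jE iE.
- move=> m n p e i s t r x y rE; apply: free_eval_inj => P f fE.
  by rewrite !(free_evalE fE); apply: op_comp_act rE.
Defined.

Definition free_gen (x : E) : free_operad 2%N := free_pi (Tgen x).

Lemma free_gen_equivariant : equivariant free_gen.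
Proof.
split=> [a x y|s x]; apply: free_eval_inj => P f fE; have [fl fa] := fE.
  by rewrite free_evalD // free_evalZ // !free_eval_pi //= fl.
by rewrite (free_eval_act fE) !free_eval_pi //= fa.
Qed.

Lemma free_operad_universal (P : operad K) (f : E -> P 2%N) : equivariant f ->
  (exists2 F : forall n, free_operad n -> P n,
     operad_morphism F & forall x, F 2%N (free_gen x) = f x) /\
  (forall F G : forall n, free_operad n -> P n,
     operad_morphism F -> operad_morphism G ->
     (forall x, F 2%N (free_gen x) = G 2%N (free_gen x)) ->
     forall n x, F n x = G n x).
Proof.
move=> fE; split.
  exists (@free_eval P f); last by move=> x; apply: free_eval_pi.
  split=> [n a x y||n s x|m n p e i x y].
  - by rewrite free_evalD // free_evalZ.
  - exact: free_eval_id.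
  - exact: free_eval_act.
  - exact: free_eval_comp.
move=> F G [Fl F1 Fa Fc] [Gl G1 Ga Gc] FG n.
have F0 k : F k 0 = 0 by have := Fl k (-1) 0 0; rewrite !scaleN1r !addNr.
have G0 k : G k 0 = 0 by have := Gl k (-1) 0 0; rewrite !scaleN1r !addNr.
elim/free_piW; elim=> {n}.
- exact: FG.
- exact: etrans F1 (esym G1).
- move=> n s t IH; have -> : free_pi (Tact s t) = op_act free_operad s (free_pi t).
    by apply: free_eval_inj => Q g gE; rewrite (free_eval_act gE) !free_eval_pi.
  by rewrite Fa Ga IH.
- move=> m n p e i t IHt u IHu.
  have -> : free_pi (Tcomp e i t u) =
      op_comp free_operad e i (free_pi t) (free_pi u).
    by apply: free_eval_inj => Q g gE; rewrite (free_eval_comp gE) !free_eval_pi.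
  by rewrite Fc Gc IHt IHu.
- by move=> n; rewrite [free_pi _](_ : _ = 0) // F0 G0.
- move=> n t IHt u IHu; rewrite -free_piD -[free_pi t]scale1r.
  by rewrite Fl Gl IHt IHu.
- move=> n a t IH; rewrite -free_piZ -[_ *: _]addr0.
  by rewrite Fl Gl IH F0 G0.
Qed.

End FreeOperad.

Definition family (K : fieldType) (P : operad K) := forall n, P n -> Prop.

Record operad_ideal (K : fieldType) (P : operad K) (I : family P) : Prop :=
  OperadIdeal {
    oi0 : forall n, I n 0;
    oiP : forall n a (x y : P n), I n x -> I n y -> I n (a *: x + y);
    oi_act : forall n (s : 'S_n) (x : P n), I n x -> I n (op_act P s x);
    oi_compl : forall m n p (e : (m + n = p.+1)%N) (i : 'I_m) (x : P m) (y : P n),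
      I m x -> I p (op_comp P e i x y);
    oi_compr : forall m n p (e : (m + n = p.+1)%N) (i : 'I_m) (x : P m) (y : P n),
      I n y -> I p (op_comp P e i x y)
  }.

Section QuotientOperad.
Variables (K : fieldType) (P : operad K) (I : family P) (idI : operad_ideal I).

Definition ideal_eq n (x y : P n) : Prop := I (x - y).

Let IZ n a (x : P n) : I x -> I (a *: x).
Proof. by move=> Ix; rewrite -[_ *: _]addr0; apply: oiP => //; apply: oi0. Qed.
Let ID n (x y : P n) : I x -> I y -> I (x + y).
Proof. by move=> Ix Iy; rewrite -[x]scale1r; apply: oiP. Qed.
Let Irefl n (x y : P n) : x = y -> ideal_eq x y.
Proof. by move=> ->; rewrite /ideal_eq subrr; apply: oi0. Qed.

Definition ideal_premodule (n : nat) : premodule K.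
Proof.
apply: (@Premodule K (P n) 0 +%R *:%R (@ideal_eq n)) => /=.
- by move=> x; apply: Irefl.
- by move=> x y; rewrite /ideal_eq => xy; rewrite -opprB -scaleN1r; apply: IZ.
- move=> x y z; rewrite /ideal_eq => xy yz.
  by rewrite -[x](subrK y) -addrA; apply: ID.
- move=> x x' y y'; rewrite /ideal_eq => xx' yy'.
  by rewrite opprD addrACA; apply: ID.
- by move=> a x x'; rewrite /ideal_eq => xx'; rewrite -scalerBr; apply: IZ.
- by move=> x y z; apply: Irefl; rewrite addrA.
- by move=> x y; apply: Irefl; rewrite addrC.
- by move=> x; apply: Irefl; rewrite add0r.
- by move=> x; apply: Irefl; rewrite scaleN1r addNr.
- by move=> a b x; apply: Irefl; rewrite scalerA.
- by move=> x; apply: Irefl; rewrite scale1r.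
- by move=> a x y; apply: Irefl; rewrite scalerDr.
- by move=> x a b; apply: Irefl; rewrite scalerDl.
Defined.

Definition quot_sort (n : nat) : lmodType K := quot_mod (ideal_premodule n).

Definition quot_pi n (x : P n) : quot_sort n := @qpi K (ideal_premodule n) x.
Definition quot_repr n (u : quot_sort n) : P n := @qrepr K (ideal_premodule n) u.

Definition quot_act n (s : 'S_n) (u : quot_sort n) : quot_sort n :=
  quot_pi (op_act P s (quot_repr u)).
Definition quot_comp m n p (e : (m + n = p.+1)%N) (i : 'I_m)
    (u : quot_sort m) (v : quot_sort n) : quot_sort p :=
  quot_pi (op_comp P e i (quot_repr u) (quot_repr v)).

Lemma quot_piP n (x y : P n) : quot_pi x = quot_pi y <-> I (x - y).
Proof. exact: (@qpiP K (ideal_premodule n)). Qed.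
Lemma quot_reprP n (x : P n) : I (quot_repr (quot_pi x) - x).
Proof. exact: (@qreprP K (ideal_premodule n)). Qed.
Lemma quot_piW n (A : quot_sort n -> Prop) :
  (forall x, A (quot_pi x)) -> forall u, A u.
Proof. exact: (@qpiW K (ideal_premodule n)). Qed.
Lemma quot_piD n (x y : P n) : quot_pi x + quot_pi y = quot_pi (x + y).
Proof. exact: (@qpiD K (ideal_premodule n)). Qed.
Lemma quot_piZ n a (x : P n) : a *: quot_pi x = quot_pi (a *: x).
Proof. exact: (@qpiZ K (ideal_premodule n)). Qed.

Lemma quot_actE n (s : 'S_n) (x : P n) :
  quot_act s (quot_pi x) = quot_pi (op_act P s x).
Proof.
apply/quot_piP; have /(oi_act idI s) := quot_reprP x.
by rewrite -[_ - _]addrC -scaleN1r op_act_linear scaleN1r addrC.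
Qed.
Lemma quot_compE m n p (e : (m + n = p.+1)%N) (i : 'I_m) (x : P m) (y : P n) :
  quot_comp e i (quot_pi x) (quot_pi y) = quot_pi (op_comp P e i x y).
Proof.
transitivity (quot_pi (op_comp P e i x (quot_repr (quot_pi y)))); apply/quot_piP.
  have /(oi_compl idI e i (quot_repr (quot_pi y))) := quot_reprP x.
  by rewrite -[_ - _]addrC -scaleN1r op_comp_linearl scaleN1r addrC.
have /(oi_compr idI e i x) := quot_reprP y.
by rewrite -[_ - _]addrC -scaleN1r op_comp_linearr scaleN1r addrC.
Qed.

Definition quot_piE := (quot_actE, quot_compE).

Definition quot_operad : operad K.
Proof.
apply: (@Operad K quot_sort quot_act (quot_pi (op_id P)) quot_comp).
- move=> n s a; elim/quot_piW=> x; elim/quot_piW=> y.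
  by rewrite quot_piZ quot_piD !quot_actE quot_piZ quot_piD op_act_linear.
- by move=> n; elim/quot_piW=> x; rewrite !quot_piE op_act1.
- by move=> n s t; elim/quot_piW=> x; rewrite !quot_piE op_actM.
- move=> m n p e i; elim/quot_piW=> y a; elim/quot_piW=> x; elim/quot_piW=> x'.
  by rewrite quot_piZ quot_piD !quot_compE quot_piZ quot_piD op_comp_linearl.
- move=> m n p e i; elim/quot_piW=> x a; elim/quot_piW=> y; elim/quot_piW=> y'.
  by rewrite quot_piZ quot_piD !quot_compE quot_piZ quot_piD op_comp_linearr.
- by move=> n e i; elim/quot_piW=> x; rewrite !quot_piE op_comp1l.
- by move=> n e i; elim/quot_piW=> x; rewrite !quot_piE op_comp1r.
- move=> l m n p q r e1 e2 e3 e4 i j k.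
  elim/quot_piW=> x; elim/quot_piW=> y; elim/quot_piW=> z kE; rewrite !quot_piE.
  by rewrite (op_comp_seq e1 e2 e3 e4 _ _ _ kE).
- move=> l m n p q r e1 e2 e3 e4 i j j' i'.
  elim/quot_piW=> x; elim/quot_piW=> y; elim/quot_piW=> z ij jE iE.
  by rewrite !quot_piE (op_comp_par e1 e2 e3 e4 _ _ _ ij jE iE).
- move=> m n p e i s t r; elim/quot_piW=> x; elim/quot_piW=> y rE.
  by rewrite !quot_piE (op_comp_act e _ _ rE).
Defined.

End QuotientOperad.

(** The ideal (R) generated by a set R of operations of arity 3. *)
Definition ideal_gen (K : fieldType) (P : operad K) (R : P 3%N -> Prop) : family P :=
  fun n x => forall I : family P,
    operad_ideal I -> (forall y, R y -> I 3%N y) -> I n x.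

Lemma ideal_gen_ideal (K : fieldType) (P : operad K) (R : P 3%N -> Prop) :
  operad_ideal (ideal_gen R).
Proof.
split.
- by move=> n I idI RI; apply: oi0.
- by move=> n a x y Ix Iy I idI RI; apply: oiP => //; [apply: Ix|apply: Iy].
- by move=> n s x Ix I idI RI; apply: oi_act => //; apply: Ix.
- by move=> m n p e i x y Ix I idI RI; apply: oi_compl => //; apply: Ix.
- by move=> m n p e i x y Iy I idI RI; apply: oi_compr => //; apply: Iy.
Qed.

(** The operad P(E, R) = T(E)/(R). *)
Definition quadratic_operad (K : fieldType) (E : binary_module K)
    (R : free_operad E 3%N -> Prop) : operad K :=
  quot_operad (ideal_gen_ideal R).

(** The S_3-submodule generated by a set of operations of arity 3. *)
Definition S3_span (K : fieldType) (P : operad K) (G : P 3%N -> Prop) : P 3%N -> Prop :=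
  fun x => forall M : P 3%N -> Prop,
    M 0 -> (forall a y z, M y -> M z -> M (a *: y + z)) ->
    (forall s y, M y -> M (op_act P s y)) ->
    (forall y, G y -> M y) -> M x.

Section KoszulDual.
Variable K : fieldType.

Section DualModule.
Variable E : binary_module K.

(** E^* tensored with the sign representation: s acts on f by
    sgn(s) f(s^-1 x). *)
Definition dual_act_fun (s : 'S_2) (f : 'Hom(E, K^o)) : 'Hom(E, K^o) :=
  ((-1) ^+ s : K) *: (f \o bm_act E s^-1%g)%VF.

Lemma dual_act_funP s : linear (dual_act_fun s).
Proof.
move=> a f g; apply/lfunP=> x; rewrite /dual_act_fun.
rewrite !(scale_lfunE, add_lfunE, comp_lfunE) /=.
by rewrite scalerDr !scalerA mulrC.
Qed.
HB.instance Definition _ s := GRing.isLinear.Build K _ _ *:%R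
  (dual_act_fun s) (dual_act_funP s).

Definition dual_module : binary_module K.
Proof.
apply: (@BinaryModule K 'Hom(E, K^o) (fun s => linfun (dual_act_fun s))).
- move=> f; apply/lfunP=> x; rewrite lfunE /= /dual_act_fun.
  by rewrite scale_lfunE comp_lfunE invg1 bm_act1 odd_perm1 scale1r.
- move=> s t f; apply/lfunP=> x; rewrite !lfunE /= /dual_act_fun.
  rewrite !(scale_lfunE, comp_lfunE) bm_actM invMg.
  by rewrite scalerA odd_permM signr_addb.
Defined.

End DualModule.

(** [op_type u a b] for u = 0, 1, 2 is the composite of type I, II, III:
    a(b(x,y),z), a(b(y,z),x), a(b(z,x),y), where x, y, z are the variables
    number 0, 1, 2.  In type u the variable k is plugged into the input
    k - u (mod 3) of a o_0 b. *)
Definition op_type (P : operad K) (u : 'I_3) (a b : P 2%N) : P 3%N :=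
  op_act P (perm (@subIr 'I_3 u)) (op_comp P (erefl : (2 + 2 = 3.+1)%N) ord0 a b).

(** Since T(E)(3) is the direct sum over u of three copies of E (x) E, spanned by the
    [op_type u a b], there is exactly one such form. *)
Definition natural_pairing (E : binary_module K)
    (B : free_operad (dual_module E) 3%N -> free_operad E 3%N -> K) : Prop :=
  [/\ forall x, linear (fun y => B y x : K^o),
      forall y, linear (fun x => B y x : K^o) &
      forall (u v : 'I_3) (f g : dual_module E) (a b : E),
        B (op_type u (free_gen f) (free_gen g)) (op_type v (free_gen a) (free_gen b))
        = (u == v)%:R * (f : 'Hom(E, K^o)) a * (g : 'Hom(E, K^o)) b].

Definition orthogonal (E : binary_module K) (R : free_operad E 3%N -> Prop) :
    free_operad (dual_module E) 3%N -> Prop :=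
  fun y => exists2 B, @natural_pairing E B & forall x, R x -> B y x = 0.

Definition koszul_dual (E : binary_module K) (R : free_operad E 3%N -> Prop) : operad K :=
  quadratic_operad (orthogonal R).

End KoszulDual.

Section TransposedPoisson.
Variable K : fieldType.

(** K mu + K nu, with mu symmetric and nu skew-symmetric. *)
Definition tp_act_fun (s : 'S_2) (x : K^o * K^o) : K^o * K^o :=
  (x.1, ((-1) ^+ s : K) *: x.2).

Lemma tp_act_funP s : linear (tp_act_fun s).
Proof.
move=> a [x1 x2] [y1 y2]; congr (_, _) => /=.
by rewrite scalerDr !scalerA mulrC.
Qed.
HB.instance Definition _ s := GRing.isLinear.Build K _ _ *:%R
  (tp_act_fun s) (tp_act_funP s).

Definition tp_module : binary_module K.
Proof.
apply: (@BinaryModule K (K^o * K^o)%type (fun s => linfun (tp_act_fun s))).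
- by case=> x1 x2; rewrite lfunE /= /tp_act_fun odd_perm1 scale1r.
- move=> s t [x1 x2]; rewrite !lfunE /= /tp_act_fun /=.
  by rewrite scalerA odd_permM signr_addb.
Defined.

Definition tp_mu : tp_module := ((1, 0) : K^o * K^o).
Definition tp_nu : tp_module := ((0, 1) : K^o * K^o).

Let T := free_operad tp_module.
Let mu : T 2%N := free_gen tp_mu.
Let nu : T 2%N := free_gen tp_nu.
Let comp3 (i : 'I_2) (a b : T 2%N) : T 3%N := op_comp T (erefl : (2 + 2 = 3.+1)%N) i a b.
Let o0 : 'I_2 := ord0.
Let o1 : 'I_2 := ord_max.
Let x : 'I_3 := 0.
Let y : 'I_3 := 1.

(** mu(mu(x,y),z) - mu(x,mu(y,z)) *)
Definition tp_assoc : T 3%N := comp3 o0 mu mu - comp3 o1 mu mu.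

(** nu(nu(x,y),z) + nu(nu(y,z),x) + nu(nu(z,x),y) *)
Definition tp_jacobi : T 3%N := \sum_(u < 3) op_type u nu nu.

(** 2 mu(x,nu(y,z)) - nu(mu(x,y),z) - nu(y,mu(x,z)) *)
Definition tp_compat : T 3%N :=
  2%:R *: comp3 o1 mu nu - comp3 o0 nu mu
  - op_act T (tperm x y) (comp3 o1 nu mu).

Definition tp_relations : T 3%N -> Prop :=
  S3_span (fun r => [\/ r = tp_assoc, r = tp_jacobi | r = tp_compat]).

Definition tp_operad : operad K := quadratic_operad tp_relations.

End TransposedPoisson.

(* Main.v *)
Require Import Defs.
From mathcomp Require Import all_boot all_algebra.
From HB Require Import structures.
From mathcomp Require Import all_order all_fingroup zify ring.

Set Implicit Arguments.
Unset Strict Implicit.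
Unset Printing Implicit Defensive.

Import GRing.Theory.
Local Open Scope ring_scope.

(** Write mu, nu for the generators of E and mu*, nu* for the dual basis of its
    Koszul dual E^*(x)sgn, in which mu* is skew-symmetric and nu* symmetric.  The
    map mu |-> nu*, nu |-> mu* is an isomorphism of S_2-modules ([to_dual],
    [to_dual_act]); it extends to an isomorphism F of free operads
    ([free_dual_iso]).  The theorem says that F maps the relations R of the
    transposed Poisson operad onto their annihilator; the quotient operads are then
    isomorphic by [quadratic_quotient_iso].

    Everything takes place in T(E)(3), which has the 12 composites a o_u b as a
    basis.  They span by induction on operadic expressions ([free_arity3_ind]).
    They are independent because T(E) maps to operads of tensors
    ([tensor_operad]): an algebra with five basis vectors, whose only non-zero
    products are x.y and (x.y).z up to symmetry, singles out the coefficient of one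
    composite ([tree_coord_op_type]).  Twisting by rotations gives all coordinates
    [coord].  In particular there is exactly one natural pairing, and through F
    it becomes an explicit bilinear form on T(E)(3) ([natural_pairing_coord_form]).

    Let c_ab(u) be the coefficient of a o_u b, with u taken modulo 3.  When 2 is
    invertible, R is the 6-dimensional space of solutions of
    - c_mumu(0) + c_mumu(1) + c_mumu(2) = 0 (associativity),
    - c_nunu(0) = c_nunu(1) = c_nunu(2) (Jacobi identity),
    - 2 c_numu(u) = c_munu(u + 2) - c_munu(u + 1) (compatibility);
    see [coord_relations_iff].  The form obtained from the pairing couples c_ab(u)
    with c_a'b'(u), where ' exchanges mu and nu.  It therefore exchanges the roles
    of associativity and the Jacobi identity, and the compatibility relations are
    orthogonal to one another: R is its own orthogonal ([coord_form_orthogonal]). *)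

(** * Operads of tensors *)

Section TensorOperad.
Variables (K : fieldType) (B : finType) (b0 : B).

(** Words of length n in the letters B, i.e. multi-indices. *)
Definition word n := {ffun 'I_n -> B}.

(** The letter number k, with the default value [b0] beyond the end.  Indexing words
    by [nat] makes the reindexings below equations between natural numbers. *)
Definition letter n (w : word n) (k : nat) : B :=
  if insub k is Some j then w j else b0.

Lemma letterE n (w : word n) (j : 'I_n) : letter w j = w j.
Proof. by rewrite /letter valK. Qed.

Lemma word_eq n (v w : word n) :
  (forall k, (k < n)%N -> letter v k = letter w k) -> v = w.
Proof. by move=> vw; apply/ffunP => j; rewrite -!letterE vw. Qed.

(** If f o_i g is applied to the word w and g produces the letter b, then f is
    applied to [outer_word n i b w] and g, of arity n, to [inner_word n i w]. *)
Definition outer_word m n p (i : 'I_m) (b : B) (w : word p) : word m :=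
  [ffun j : 'I_m => if j == i then b else letter w (outer_pos n i j)].

Definition inner_word n p (i : nat) (w : word p) : word n :=
  [ffun j : 'I_n => letter w (i + j)].

Lemma letter_outer m n p (i : 'I_m) b (w : word p) k : (k < m)%N ->
  letter (outer_word n i b w) k =
    if k == i :> nat then b else letter w (outer_pos n i k).
Proof. by move=> km; rewrite -[k]/(val (Ordinal km)) letterE ffunE. Qed.

Lemma letter_inner n p i (w : word p) k : (k < n)%N ->
  letter (inner_word n i w) k = letter w (i + k).
Proof. by move=> kn; rewrite -[k]/(val (Ordinal kn)) letterE ffunE. Qed.

Definition perm_word n (s : 'S_n) (w : word n) : word n := [ffun k => w (s^-1%g k)].

(** A tensor of arity n is given by its coefficients: the value at (w, c) is the
    coefficient of c in the product of the letters of w. *)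
Definition tensor n : lmodType K := {ffun word n * B -> K^o}.

Definition tensor_act n (s : 'S_n) (x : tensor n) : tensor n :=
  [ffun wc : word n * B => x (perm_word s wc.1, wc.2)].

Definition tensor_id : tensor 1 := [ffun wc : word 1 * B => (wc.1 ord0 == wc.2)%:R].

Definition tensor_comp m n p (e : (m + n = p.+1)%N) (i : 'I_m)
    (x : tensor m) (y : tensor n) : tensor p :=
  [ffun wc : word p * B => \sum_b x (outer_word n i b wc.1, wc.2) * y (inner_word n i wc.1, b)].

(** The endomorphism operad of the vector space with basis B. *)
Definition tensor_operad : operad K.
Proof.
apply: (@Operad K tensor tensor_act tensor_id tensor_comp).
- by move=> n s a x y; apply/ffunP => wc; rewrite !ffunE.
- move=> n x; apply/ffunP => -[w c]; rewrite ffunE; congr (x (_, _)).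
  by apply/ffunP => k; rewrite ffunE invg1 perm1.
- move=> n s t x; apply/ffunP => -[w c]; rewrite !ffunE; congr (x (_, _)).
  by apply/ffunP => k; rewrite !ffunE invMg permM.
- move=> m n p e i y a x x'; apply/ffunP => wc; rewrite !ffunE scaler_sumr -big_split.
  by apply: eq_bigr => b _; rewrite !ffunE mulrDl scalerAl.
- move=> m n p e i x a y y'; apply/ffunP => wc; rewrite !ffunE scaler_sumr -big_split.
  by apply: eq_bigr => b _; rewrite !ffunE mulrDr scalerAr.
- move=> n e i x; apply/ffunP => -[w c]; rewrite ffunE /=.
  rewrite (bigD1 c) //= big1 => [|b bc].
    rewrite !ffunE (ord1 i) /= eqxx mul1r addr0; congr (x (_, _)).
    by apply: word_eq => k kn; rewrite letter_inner.
  by rewrite !ffunE (ord1 i) /= (negPf bc) mul0r.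
- move=> n e i x; apply/ffunP => -[w c]; rewrite ffunE /=.
  rewrite (bigD1 (w i)) //= big1 => [|b bw].
    rewrite !ffunE addn0 letterE eqxx mulr1 addr0; congr (x (_, _)).
    apply: word_eq => k kn; rewrite letter_outer //; case: eqP => [->|ki].
      by rewrite letterE.
    by congr (letter w _); rewrite /outer_pos; case: ifP; lia.
  by rewrite !ffunE addn0 letterE eq_sym (negPf bw) mulr0.
- move=> l m n p q r e1 e2 e3 e4 i j k x y z kE; apply/ffunP => -[w c].
  have ? := ltn_ord i; have ? := ltn_ord j.
  rewrite !ffunE /=; under eq_bigr => b _ do rewrite ffunE mulr_suml.
  rewrite exchange_big; apply: eq_bigr => b _ /=.
  rewrite ffunE mulr_sumr; apply: eq_bigr => b' _ /=; rewrite mulrA.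
  congr (x (_, _) * y (_, _) * z (_, _)); apply: word_eq => a ak.
  + rewrite letter_outer // [RHS]letter_outer //; case: eqP => // ai.
    rewrite letter_outer; last by rewrite /outer_pos; case: ifP; lia.
    rewrite ifF; last by apply/eqP; rewrite /outer_pos; case: ifP; lia.
    by congr (letter w _); rewrite /outer_pos; do !case: ifP; lia.
  + rewrite letter_inner // [RHS]letter_outer // letter_outer; last lia.
    rewrite kE eqn_add2l; case: eqP => // aj.
    rewrite letter_inner; last by rewrite /outer_pos; case: ifP; lia.
    congr (letter w _).
    by rewrite /outer_pos; do !case: ifP; lia.
  + by rewrite !letter_inner //; [congr (letter w _)|]; lia.
- move=> l m n p q r e1 e2 e3 e4 i j j' i' x y z ij jE iE; apply/ffunP => -[w c].
  have ? := ltn_ord i; have ? := ltn_ord j.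
  rewrite !ffunE /=; under eq_bigr => b _ do rewrite ffunE mulr_suml.
  rewrite exchange_big; apply: eq_bigr => b _ /=.
  rewrite ffunE mulr_suml; apply: eq_bigr => b' _ /=; rewrite mulrAC.
  congr (x (_, _) * z (_, _) * y (_, _)); apply: word_eq => a ak.
  + rewrite !letter_outer //; try by rewrite /outer_pos; do !case: ifP; lia.
    have [ai|ai] := eqVneq a i; have [aj|aj] := eqVneq a j.
    * by exfalso; lia.
    * by rewrite ifT //; apply/eqP; rewrite /outer_pos; case: ifP; lia.
    * by rewrite ifT //; apply/eqP; rewrite /outer_pos; case: ifP; lia.
    * rewrite !ifF; try by apply/eqP; rewrite /outer_pos; do !case: ifP; lia.
      by congr (letter w _); rewrite /outer_pos; do !case: ifP; lia.
  + rewrite !letter_inner // letter_outer; last lia.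
    rewrite ifF; last by apply/eqP; lia.
    by congr (letter w _); rewrite /outer_pos; do !case: ifP; lia.
  + rewrite !letter_inner // letter_outer; last lia.
    rewrite ifF; last by apply/eqP; lia.
    by congr (letter w _); rewrite /outer_pos; do !case: ifP; lia.
- move=> m n p e i s t r x y [rO rI]; apply/ffunP => -[w c].
  have ? := ltn_ord i; have ? := ltn_ord (s i).
  rewrite !ffunE /=; apply: eq_bigr => b _; rewrite !ffunE /=.
  congr (x (_, _) * y (_, _)); apply/ffunP => a; rewrite !ffunE.
  + rewrite -[a](permKV s) permK (inj_eq perm_inj); case: eqP => // /eqP ai.
    set j := s^-1%g a in ai *.
    have oP : (outer_pos n i j < p)%N.
      have := ltn_ord j; move: ai; rewrite -val_eqE /outer_pos /=.
      by case: ifP => /=; lia.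
    rewrite -(rO j (Ordinal oP) ai erefl) letterE ffunE permK.
    by rewrite -[outer_pos n i j]/(val (Ordinal oP)) letterE.
  + rewrite -{2}[a](permKV t); set j := t^-1%g a.
    have oP : (i + j < p)%N by have := ltn_ord j; lia.
    rewrite -(rI j (Ordinal oP) erefl) letterE ffunE permK.
    by rewrite -[(i + j)%N]/(val (Ordinal oP)) letterE.
Defined.

End TensorOperad.

(** * Composites of two binary operations *)

Section OperadLinearity.
Variables (K : fieldType) (P : operad K).

HB.instance Definition _ n (s : 'S_n) := GRing.isLinear.Build K (P n) (P n) *:%R
  (op_act P s) (op_act_linear s).

Lemma op_actD n (s : 'S_n) (x y : P n) : op_act P s (x + y) = op_act P s x + op_act P s y.
Proof. exact: (linearD (op_act P s)). Qed.
Lemma op_actN n (s : 'S_n) (x : P n) : op_act P s (- x) = - op_act P s x.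
Proof. exact: (linearN (op_act P s)). Qed.
Lemma op_actZ n (s : 'S_n) k (x : P n) : op_act P s (k *: x) = k *: op_act P s x.
Proof. exact: (linearZ_LR (op_act P s)). Qed.

Section Composition.
Variables (m n p : nat) (e : (m + n = p.+1)%N) (i : 'I_m).

(** Partial composition as a function of either operation alone, so that it can
    carry the structure of a linear map. *)
Definition op_compl (y : P n) (x : P m) : P p := op_comp P e i x y.
HB.instance Definition _ y := GRing.isLinear.Build K (P m) (P p) *:%R
  (op_compl y) (op_comp_linearl e i y).

Definition op_compr (x : P m) (y : P n) : P p := op_comp P e i x y.
HB.instance Definition _ x := GRing.isLinear.Build K (P n) (P p) *:%R
  (op_compr x) (op_comp_linearr e i x).

Lemma op_comp0r x : op_comp P e i x 0 = 0.
Proof. exact: (linear0 (op_compr x)). Qed.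
Lemma op_compZr a x y : op_comp P e i x (a *: y) = a *: op_comp P e i x y.
Proof. exact: (linearZ_LR (op_compr x)). Qed.
Lemma op_compZl a x y : op_comp P e i (a *: x) y = a *: op_comp P e i x y.
Proof. exact: (linearZ_LR (op_compl y)). Qed.

End Composition.

Section OpType.
Variable u : 'I_3.

Lemma op_type_linearl (b : P 2%N) : linear (fun a => op_type u a b).
Proof. by move=> k a a'; rewrite /op_type op_comp_linearl linearP. Qed.
Lemma op_type_linearr (a : P 2%N) : linear (op_type u a).
Proof. by move=> k b b'; rewrite /op_type op_comp_linearr linearP. Qed.

End OpType.

End OperadLinearity.

Section SmallPermutations.
Implicit Types u v : 'I_3.

(** The two kinds of generators of S_3 = Z/3 x| {1, -1}, as affine maps of Z/3:
    [rot3 u] is k |-> k - u, the permutation in [op_type u], and [swap3] is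
    k |-> 1 - k, the exchange of 0 and 1. *)
Definition rot3 u : 'S_3 := perm (@subIr 'I_3 u).
Definition swap3 : 'S_3 := perm (inj_comp (@addrI 'I_3 1) (@oppr_inj 'I_3)).
Definition swap2 : 'S_2 := tperm ord0 ord_max.

Lemma ord2_cases (i : 'I_2) : i = ord0 \/ i = ord_max.
Proof. by case: i => [[|[|]]] // lti; [left|right]; apply: val_inj. Qed.

Lemma perm2_cases (s : 'S_2) : s = 1%g \/ s = swap2.
Proof.
have [s0|s0] := ord2_cases (s ord0); have [s1|s1] := ord2_cases (s ord_max).
- by have := perm_inj (etrans s0 (esym s1)).
- by left; apply/permP => i; rewrite perm1; have [->|->] := ord2_cases i.
- by right; apply/permP => i; have [->|->] := ord2_cases i; rewrite ?tpermL ?tpermR.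
- by have := perm_inj (etrans s0 (esym s1)).
Qed.

Lemma ord3_cases u : [\/ u = 0, u = 1 | u = 2%:R].
Proof.
by case: u => [[|[|[|]]]] // ltu; [apply: Or31|apply: Or32|apply: Or33]; apply: val_inj.
Qed.

Lemma perm3_cases (s : 'S_3) : exists u, s = rot3 u \/ s = (rot3 u * swap3)%g.
Proof.
have inj (i j : 'I_3) : s i = s j -> i = j by exact: perm_inj.
suff [u su] : exists u, (forall k, s k = k - u) \/ (forall k, s k = 1 - (k - u)).
  exists u; case: su => su; [left|right]; apply/permP => k; rewrite ?permM !permE;
  exact: su.
have := inj 0 1; have := inj 0 2%:R; have := inj 1 2%:R.
have I (f : 'I_3 -> 'I_3) : f 0 = s 0 -> f 1 = s 1 -> f 2%:R = s 2%:R ->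
  forall k, s k = f k by move=> ? ? ? k; have [->|->|->] := ord3_cases k.
(* The 27 maps from Z/3 to itself are tried; injectivity leaves six of them. *)
by have [s0|s0|s0] := ord3_cases (s 0); have [s1|s1|s1] := ord3_cases (s 1);
 have [s2|s2|s2] := ord3_cases (s 2%:R); rewrite s0 s1 s2 => // H1 H2 H3;
 try (by have := H1 erefl); try (by have := H2 erefl); try (by have := H3 erefl);
 first [ by exists 0; left; apply: I; rewrite ?s0 ?s1 ?s2; apply: val_inj
 | by exists 0; right; apply: I; rewrite ?s0 ?s1 ?s2; apply: val_inj
 | by exists 1; left; apply: I; rewrite ?s0 ?s1 ?s2; apply: val_inj
 | by exists 1; right; apply: I; rewrite ?s0 ?s1 ?s2; apply: val_inj
 | by exists 2%:R; left; apply: I; rewrite ?s0 ?s1 ?s2; apply: val_inj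
 | by exists 2%:R; right; apply: I; rewrite ?s0 ?s1 ?s2; apply: val_inj ].
Qed.

Lemma odd_swap2 : odd_perm swap2 = true.
Proof. by rewrite odd_tperm. Qed.

(** [swap3] is the block permutation that exchanges the inputs of b in a o_0 b. *)
Lemma block_swap2 : block_perm (ord0 : 'I_2) 1%g swap2 swap3.
Proof.
split=> j k; have [->|->] := ord2_cases j; rewrite ?eqxx // => kE.
- move=> {}kE; rewrite !perm1.
  by have -> : k = 2%:R by [apply: val_inj; rewrite /= kE]; rewrite permE.
- by have -> : k = 0 by [apply: val_inj; rewrite /= kE]; rewrite permE perm1 tpermL.
- by have -> : k = 1 by [apply: val_inj; rewrite /= kE]; rewrite permE perm1 tpermR.
Qed.

(** Exchanging the inputs of a in a o_0 b gives a o_1 b up to a rotation. *)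
Lemma block_swap_outer : block_perm (ord0 : 'I_2) swap2 (1%g : 'S_2) (rot3 (-1)).
Proof.
split=> j k; have [->|->] := ord2_cases j; rewrite ?eqxx // => kE.
- move=> {}kE; rewrite tpermL tpermR; have -> : k = 2%:R by [apply: val_inj; rewrite /= kE].
  by rewrite permE.
- by have -> : k = 0 by [apply: val_inj; rewrite /= kE]; rewrite permE perm1 tpermL.
- by have -> : k = 1 by [apply: val_inj; rewrite /= kE]; rewrite permE perm1 tpermL.
Qed.

End SmallPermutations.

Section OpTypeAction.
Variables (K : fieldType) (P : operad K).
Implicit Types (a b : P 2%N) (u v : 'I_3).

Lemma op_act_rot u v a b : op_act P (rot3 v) (op_type u a b) = op_type (u + v) a b.
Proof.
rewrite /op_type op_actM; congr (op_act P _ _).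
by apply/permP => k; rewrite permM !permE opprD addrA addrAC.
Qed.

Lemma op_act_swap u a b :
  op_act P swap3 (op_type u a b) = op_type (- u) a (op_act P swap2 b).
Proof.
rewrite /op_type -{2}[a]op_act1 (op_comp_act _ _ _ block_swap2) perm1 !op_actM.
congr (op_act P _ _); apply/permP => k.
by rewrite !permM !permE /= opprK opprD addrA addrAC.
Qed.

(** a(x, b(y, z)) is the composite of type II of b and of a with its inputs exchanged;
    hence it is plus or minus a o_II b when a is symmetric or skew-symmetric. *)
Lemma op_comp_last a b :
  op_comp P (erefl : (2 + 2 = 3.+1)%N) ord_max a b = op_type 1 (op_act P swap2 a) b.
Proof.
rewrite /op_type -{2}[b]op_act1 (op_comp_act _ _ _ block_swap_outer) tpermL op_actM.
rewrite -[LHS]op_act1; congr (op_act P _ _); apply/permP => k.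
by rewrite permM perm1 !permE /= opprK subrK.
Qed.

Lemma op_comp_first a b :
  op_comp P (erefl : (2 + 2 = 3.+1)%N) ord0 a b = op_type 0 a b.
Proof.
rewrite /op_type -[LHS]op_act1; congr (op_act P _ _); apply/permP => k.
by rewrite perm1 permE subr0.
Qed.

End OpTypeAction.

(** * The free operad in arity 3 *)

Section FreeArity3.
Variables (K : fieldType) (E : binary_module K).
Let T := free_operad E.

(** x is in the span of the composites a o_u b of generators. *)
Definition op_type_span (x : T 3%N) : Prop :=
  forall M : T 3%N -> Prop,
    M 0 -> (forall k y z, M y -> M z -> M (k *: y + z)) ->
    (forall u (a b : E), M (op_type u (free_gen a) (free_gen b))) -> M x.

Lemma free_gen_linear : linear (@free_gen K E).
Proof. by have [] := free_gen_equivariant E. Qed.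

HB.instance Definition _ := GRing.isLinear.Build K E (T 2%N) *:%R
  (@free_gen K E) free_gen_linear.

Lemma free_gen_act s (a : E) : free_gen (bm_act E s a) = op_act T s (free_gen a).
Proof. by have [_ ->] := free_gen_equivariant E. Qed.

Lemma op_type_spanP k x y : op_type_span x -> op_type_span y -> op_type_span (k *: x + y).
Proof. by move=> Sx Sy M M0 MP MG; apply: (MP); [apply: Sx|apply: Sy]. Qed.

Lemma op_type_span_act s x : op_type_span x -> op_type_span (op_act T s x).
Proof.
move=> Sx M M0 MP MG; apply: (Sx (fun x => M (op_act T s x))) => [|k y z My Mz|u a b].
- by rewrite linear0.
- by rewrite linearP; apply: MP.
- have [v [->|->]] := perm3_cases s; first by rewrite op_act_rot; apply: MG.
  by rewrite -op_actM op_act_swap op_act_rot -free_gen_act; apply: MG.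
Qed.

(** The shape of the elements of T(E)(n) for n < 4; there is no claim in higher
    arity.  Arity 0 is needed because composing with an operation without inputs
    lowers the arity. *)
Definition small_arity_form n : T n -> Prop :=
  match n return T n -> Prop with
  | 0 => fun x => x = 0
  | 1 => fun x => exists k, x = k *: op_id T
  | 2 => fun x => exists a, x = free_gen a
  | 3 => op_type_span
  | _ => fun=> True
  end.

Lemma small_arity_formP n k (x y : T n) :
  small_arity_form x -> small_arity_form y -> small_arity_form (k *: x + y).
Proof.
case: n x y => [|[|[|[|n]]]] //= x y.
- by move=> -> ->; rewrite scaler0 addr0.
- by move=> [a ->] [b ->]; exists (k * a + b); rewrite scalerDl scalerA.
- by move=> [a ->] [b ->]; exists (k *: a + b); rewrite linearP.
- exact: op_type_spanP.
Qed.

Lemma small_arity_form0 n : small_arity_form (0 : T n).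
Proof.
case: n => [|[|[|[|n]]]] //=.
  by exists 0; rewrite scale0r.
by exists 0; rewrite linear0.
Qed.

Lemma small_arity_formZ n k (x : T n) : small_arity_form x -> small_arity_form (k *: x).
Proof.
by move=> Sx; rewrite -[_ *: _]addr0; apply: small_arity_formP => //; apply: small_arity_form0.
Qed.

Lemma small_arity_form_act n s (x : T n) :
  small_arity_form x -> small_arity_form (op_act T s x).
Proof.
case: n s x => [|[|[|[|n]]]] // s x; rewrite /small_arity_form.
- by move=> ->; rewrite linear0.
- move=> [k ->]; exists k; have -> : s = 1%g by apply/permP => i; rewrite !ord1.
  by rewrite op_act1.
- by move=> [a ->]; exists (bm_act E s a); rewrite free_gen_act.
- exact: op_type_span_act.
Qed.

Lemma small_arity_form_comp m n p (e : (m + n = p.+1)%N) (i : 'I_m) (x : T m) (y : T n) :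
  small_arity_form x -> small_arity_form y -> small_arity_form (op_comp T e i x y).
Proof.
case: n e y => [|[|n]] e y.
- move=> _ y0; rewrite [y]y0 op_comp0r; apply: small_arity_form0.
- have mp : m = p by lia.
  subst p => Sx [k ->]; rewrite op_compZr op_comp1r; exact: small_arity_formZ.
case: m e i x => [|[|m]] e i x; first by case: i.
  have np : n.+2 = p by lia.
  by subst p => -[k ->] Sy; rewrite op_compZl op_comp1l; apply: small_arity_formZ.
(* Both arities are now at least 2, so the composite has arity at least 3,
   with equality only for two binary operations. *)
case: m n e i x y => [|m] [|n] e i x y; last 3 first.
- by case: p e => [|[|[|[|p]]]] //= e; lia.
- by case: p e => [|[|[|[|p]]]] //= e; lia.
- by case: p e => [|[|[|[|p]]]] //= e; lia.
have p3 : p = 3%N by lia.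
subst p; have -> : e = erefl by apply: eq_irrelevance.
move=> [a ->] [b ->] M M0 MP MG.
have [->|->] := ord2_cases i; first by rewrite op_comp_first; apply: MG.
by rewrite op_comp_last -free_gen_act; apply: MG.
Qed.

Lemma free_pi_act n (s : 'S_n) (t : opterm E n) :
  free_pi (Tact s t) = op_act T s (free_pi t).
Proof. by apply: free_eval_inj => P f fE; rewrite (free_eval_act fE) !free_eval_pi. Qed.

Lemma free_pi_comp m n p (e : (m + n = p.+1)%N) (i : 'I_m)
    (t : opterm E m) (u : opterm E n) :
  free_pi (Tcomp e i t u) = op_comp T e i (free_pi t) (free_pi u).
Proof. by apply: free_eval_inj => P f fE; rewrite (free_eval_comp fE) !free_eval_pi. Qed.

Lemma small_arity_form_all n (x : T n) : small_arity_form x.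
Proof.
elim/free_piW: x; elim=> {n} [a||n s t IH|m n p e i t IHt u IHu|n|n t IHt u IHu|n k t IH].
- by exists a.
- by exists 1; rewrite scale1r.
- by rewrite free_pi_act; apply: small_arity_form_act.
- by rewrite free_pi_comp; apply: small_arity_form_comp.
- exact: small_arity_form0.
- by rewrite -free_piD -[free_pi t]scale1r; apply: small_arity_formP.
- by rewrite -free_piZ; apply: small_arity_formZ.
Qed.

(** T(E)(3) is spanned by the composites a o_u b of generators. *)
Lemma free_arity3_ind (M : T 3%N -> Prop) :
  M 0 -> (forall k y z, M y -> M z -> M (k *: y + z)) ->
  (forall u (a b : E), M (op_type u (free_gen a) (free_gen b))) ->
  forall x, M x.
Proof. by move=> M0 MP MG x; apply: (small_arity_form_all x). Qed.

End FreeArity3.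

(** * A model that isolates one composite *)

Section Coordinates.
Variable K : fieldType.
Let E := tp_module K.
Let T := free_operad E.
Implicit Types (i j : bool) (a b : E) (u v : 'I_3).

(** The coefficient of mu (i = false) or of nu (i = true); this convention for
    booleans is used for all pairs (mu, nu) below. *)
Definition tp_coef i (a : K^o * K^o) : K := if i then a.2 else a.1.

Lemma tp_coefP i k (a b : E) : tp_coef i (k *: a + b) = k * tp_coef i a + tp_coef i b.
Proof. by case: i. Qed.

Lemma tp_coef_act i (s : 'S_2) a : tp_coef i (bm_act E s a) = (-1) ^+ (i && s) * tp_coef i a.
Proof. by rewrite lfunE /=; case: i; rewrite //= mul1r. Qed.

(** 1 if (p, q) = (p0, q0), and if (p, q) = (q0, p0) the sign that makes this
    symmetric or skew-symmetric as the generator number i is. *)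
Definition signed_match i (p q p0 q0 : nat) : K :=
  ((p == p0) && (q == q0))%:R + (-1) ^+ i * ((p == q0) && (q == p0))%:R.

Lemma signed_matchC i p q p0 q0 :
  signed_match i q p p0 q0 = (-1) ^+ i * signed_match i p q p0 q0.
Proof.
rewrite /signed_match mulrDr mulrA -signr_addb addbb expr0 mul1r addrC.
by congr (_ * _%:R + _%:R); rewrite andbC.
Qed.

Let V := @tensor_operad K 'I_5 ord0.

(** A product on the space with basis 0, .., 4 for each a in E: the generator number
    j gives 0.1 = 3 and the generator number i gives 3.2 = 4, together with the
    products forced by symmetry; all others are zero. *)
Definition tree_op i j a : V 2%N :=
  [ffun wc : word 'I_5 2 * 'I_5 =>
    let p := letter ord0 wc.1 0 in let q := letter ord0 wc.1 1 in
    (wc.2 == 3 :> nat)%:R * signed_match j p q 0 1 * tp_coef j a +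
    (wc.2 == 4 :> nat)%:R * signed_match i p q 3 2 * tp_coef i a].

Lemma tree_op_equivariant i j : equivariant (tree_op i j).
Proof.
split=> [k a b|s a].
  by apply/ffunP => wc; rewrite !ffunE /= !tp_coefP /GRing.scale /=; ring.
have [->|->] := perm2_cases s; first by rewrite bm_act1 op_act1.
apply/ffunP => -[w c]; rewrite !ffunE /= !tp_coef_act odd_swap2 !andbT.
have L0 : letter ord0 (perm_word swap2 w) 0 = letter ord0 w 1.
  by rewrite -[0%N]/(val (ord0 : 'I_2)) letterE ffunE tpermV tpermL -(letterE ord0).
have L1 : letter ord0 (perm_word swap2 w) 1 = letter ord0 w 0.
  by rewrite -[1%N]/(val (ord_max : 'I_2)) letterE ffunE tpermV tpermR -(letterE ord0).
by rewrite L0 L1 (signed_matchC j (letter ord0 w 0)) (signed_matchC i (letter ord0 w 0)); ring.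
Qed.

(** The inputs 0, 1, 2 of the model, at which ternary operations are evaluated. *)
Definition word012 : word 'I_5 3 := [ffun k : 'I_3 => widen_ord (isT : (3 <= 5)%N) k].

(** The coefficient of e_i(e_j(x, y), z), read off as the coefficient of the basis
    vector 4 in the value at (0, 1, 2). *)
Definition tree_coord i j (x : T 3%N) : K :=
  (free_eval (tree_op i j) x : {ffun _}) (word012, ord_max).

Lemma letter_rot3 u k : (k < 3)%N ->
  letter ord0 (perm_word (rot3 u) word012) k = ((k + u) %% 3)%N :> nat.
Proof.
move=> k3; rewrite -{1}[k]/(val (Ordinal k3)) letterE ffunE.
have -> : (rot3 u)^-1%g (Ordinal k3) = Ordinal k3 + u.
  by apply: (@perm_inj _ (rot3 u)); rewrite permKV permE addrK.
by rewrite ffunE.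
Qed.

Lemma tree_coord_op_type i j u a b :
  tree_coord i j (op_type u (free_gen a) (free_gen b)) =
    (u == 0)%:R * tp_coef i a * tp_coef j b.
Proof.
have fE := tree_op_equivariant i j.
rewrite /tree_coord /op_type (free_eval_act fE) (free_eval_comp fE) !free_eval_pi // ffunE /=.
rewrite ffunE /=; under eq_bigr => c _.
  rewrite !ffunE /= !mul0r !add0r !mul1r.
  rewrite !letter_outer // !letter_inner //= /outer_pos /= !letter_rot3 //.
  over.
rewrite !big_ord_recl big_ord0 /= /signed_match.
by have [->|->|->] := ord3_cases u; rewrite /= /bump /=; ring.
Qed.
End Coordinates.

(** * Coordinates on T(E)(3) *)

Section Relations.
Variable K : fieldType.
Let E := tp_module K.
Let T := free_operad E.
Implicit Types (i j : bool) (a b : E) (u v : 'I_3) (x y : T 3%N).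

(** The basis (mu, nu) of E. *)
Definition tp_gen i : E := if i then tp_nu K else tp_mu K.

Lemma tp_genE a : a = tp_coef false a *: tp_gen false + tp_coef true a *: tp_gen true.
Proof.
case: a => a1 a2; congr (_, _) => /=; rewrite /tp_coef /GRing.scale /=.
- by rewrite mulr1 mulr0 addr0.
- by rewrite mulr1 mulr0 add0r.
Qed.

Lemma tp_coef_gen i j : tp_coef i (tp_gen j) = (i == j)%:R.
Proof. by case: i; case: j. Qed.

Lemma tree_coordP i j k x y :
  tree_coord i j (k *: x + y) = k * tree_coord i j x + tree_coord i j y.
Proof.
have fE := tree_op_equivariant K i j.
by rewrite /tree_coord (free_evalD fE) (free_evalZ fE) !ffunE.
Qed.

(** The coefficient of e_i o_u e_j. *)
Definition coord i j u x : K := tree_coord i j (op_act T (rot3 (- u)) x).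

Lemma coord_linear i j u : linear (coord i j u : T 3%N -> K^o).
Proof. by move=> k x y; rewrite /coord linearP tree_coordP. Qed.
HB.instance Definition _ i j u := GRing.isLinear.Build K (T 3%N) K^o *:%R
  (coord i j u) (coord_linear i j u).

Lemma coordP i j u k x y : coord i j u (k *: x + y) = k * coord i j u x + coord i j u y.
Proof. exact: (linearP (coord i j u)). Qed.
Lemma coordD i j u x y : coord i j u (x + y) = coord i j u x + coord i j u y.
Proof. exact: (linearD (coord i j u)). Qed.
Lemma coordN i j u x : coord i j u (- x) = - coord i j u x.
Proof. exact: (linearN (coord i j u)). Qed.
Lemma coordZ i j u k x : coord i j u (k *: x) = k * coord i j u x.
Proof. exact: (linearZ_LR (coord i j u)). Qed.
Lemma coord0 i j u : coord i j u 0 = 0.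
Proof. exact: (linear0 (coord i j u)). Qed.

Lemma coord_op_type i j u v a b :
  coord i j u (op_type v (free_gen a) (free_gen b)) =
    (v == u)%:R * tp_coef i a * tp_coef j b.
Proof. by rewrite /coord op_act_rot tree_coord_op_type subr_eq0. Qed.

Lemma coord_rot i j u v x : coord i j u (op_act T (rot3 v) x) = coord i j (u - v) x.
Proof.
rewrite /coord op_actM; congr (tree_coord _ _ (op_act T _ _)).
by apply/permP => k; rewrite permM !permE !opprK addrA.
Qed.

Lemma coord_swap i j u x :
  coord i j u (op_act T swap3 x) = (-1) ^+ j * coord i j (- u) x.
Proof.
move: x; apply: free_arity3_ind => [|k y z Hy Hz|v a b].
- by rewrite !linear0 mulr0.
- by rewrite !linearP /= Hy Hz /GRing.scale /=; ring.
- rewrite op_act_swap -free_gen_act !coord_op_type tp_coef_act odd_swap2 andbT.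
  by rewrite eqr_oppLR; ring.
Qed.

(** The composites of mu and nu form a basis of T(E)(3). *)
Lemma coord_expansion x : x = \sum_u \sum_i \sum_j
  coord i j u x *: op_type u (free_gen (tp_gen i)) (free_gen (tp_gen j)).
Proof.
move: x; apply: free_arity3_ind => [|k y z Hy Hz|v a b].
- by rewrite big1 // => u _; rewrite big1 // => i _; rewrite big1 // => j _;
    rewrite linear0 scale0r.
- rewrite {1}Hy {1}Hz scaler_sumr -big_split; apply: eq_bigr => u _ /=.
  rewrite scaler_sumr -big_split; apply: eq_bigr => i _ /=.
  rewrite scaler_sumr -big_split; apply: eq_bigr => j _ /=.
  by rewrite linearP scalerDl scalerA.
rewrite (bigD1 v) //= [X in _ + X]big1 => [|u uv]; last first.
  rewrite big1 // => i _; rewrite big1 // => j _.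
  by rewrite coord_op_type eq_sym (negPf uv) !mul0r scale0r.
(* Both factors are expanded in the basis (mu, nu). *)
have bilin (f : E -> E -> T 3%N) : (forall c, linear (f^~ c)) -> (forall c, linear (f c)) ->
    f a b = \sum_i \sum_j (tp_coef i a * tp_coef j b) *: f (tp_gen i) (tp_gen j).
  move=> fl fr; have f0l c : f 0 c = 0.
    by have := fl c (-1) 0 0; rewrite !scaleN1r !addNr.
  have f0r c : f c 0 = 0 by have := fr c (-1) 0 0; rewrite !scaleN1r !addNr.
  rewrite !big_bool /= {1}[a]tp_genE fl -[_ *: tp_gen true]addr0 fl f0l addr0.
  rewrite [b]tp_genE !fr -[_ *: tp_gen true]addr0 !fr !f0r !addr0 -tp_genE.
  by rewrite !scalerDr !scalerA addrC; congr (_ + _); rewrite addrC.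
rewrite addr0.
apply: (etrans (bilin (fun a b => op_type v (free_gen a) (free_gen b)) _ _)).
- by move=> c k a1 a2; rewrite free_gen_linear op_type_linearl.
- by move=> c k a1 a2; rewrite free_gen_linear op_type_linearr.
apply: eq_bigr => i _; apply: eq_bigr => j _.
by rewrite coord_op_type eqxx mul1r.
Qed.

Lemma coord_inj x y : (forall i j u, coord i j u x = coord i j u y) -> x = y.
Proof.
move=> xy; rewrite [x]coord_expansion [y]coord_expansion.
by do 3!apply: eq_bigr => ? _; rewrite xy.
Qed.

Lemma swap2_mu : op_act T swap2 (free_gen (tp_mu K)) = free_gen (tp_mu K).
Proof.
rewrite -free_gen_act; congr free_gen; rewrite lfunE /= /tp_act_fun /=.
by rewrite scaler0.
Qed.

Lemma swap2_nu : op_act T swap2 (free_gen (tp_nu K)) = - free_gen (tp_nu K).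
Proof.
rewrite -free_gen_act -linearN; congr free_gen; rewrite lfunE /= /tp_act_fun odd_swap2 /=.
by congr (_, _); rewrite ?oppr0 // scaleN1r.
Qed.

(** The basis of T(E)(3) dual to the coordinates. *)
Definition tp_basis u i j : T 3%N := op_type u (free_gen (tp_gen i)) (free_gen (tp_gen j)).

Lemma coord_basis i j u v k l :
  coord i j u (tp_basis v k l) = (v == u)%:R * (i == k)%:R * (j == l)%:R.
Proof. by rewrite coord_op_type !tp_coef_gen. Qed.

Lemma op_type_oppl u (a b : T 2%N) : op_type u (- a) b = - op_type u a b.
Proof.
have := op_type_linearl u b (-1) a 0; rewrite addr0 !scaleN1r => ->.
have := op_type_linearl u b (-1) 0 0; rewrite !scaleN1r !addNr => ->.
by rewrite addr0.
Qed.

Lemma tp_assocE : tp_assoc K = tp_basis 0 false false - tp_basis 1 false false.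
Proof. by rewrite /tp_assoc op_comp_first op_comp_last swap2_mu. Qed.

Lemma tp_jacobiE : tp_jacobi K = \sum_u tp_basis u true true.
Proof. by []. Qed.

Lemma tp_compatE :
  tp_compat K = 2%:R *: tp_basis 1 false true - tp_basis 0 true false + tp_basis 2%:R true false.
Proof.
rewrite /tp_compat op_comp_first !op_comp_last swap2_mu swap2_nu op_type_oppl linearN opprK.
congr (_ + _); have -> : tperm (0 : 'I_3) 1 = swap3.
  apply/permP => k; rewrite permE /= permE /=.
  by have [->|->|->] := ord3_cases k; apply: val_inj.
rewrite [LHS]op_act_swap swap2_mu; congr (op_type _ _ _); exact: val_inj.
Qed.
End Relations.

(** * The relations in coordinates and their orthogonal *)

Section RelationCoordinates.
Variable K : fieldType.
Let T := free_operad (tp_module K).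
Implicit Types (x y : T 3%N) (u v : 'I_3).

(** The equations satisfied by the coordinates of the relations. *)
Definition coord_relations x : Prop :=
  [/\ \sum_u coord false false u x = 0,
      forall u, coord true true u x = coord true true 0 x &
      forall u, 2%:R * coord true false u x =
        coord false true (u + 2%:R) x - coord false true (u + 1) x].

Lemma coord_relationsP k x y :
  coord_relations x -> coord_relations y -> coord_relations (k *: x + y).
Proof.
move=> [x1 x2 x3] [y1 y2 y3]; split=> [|u|u].
- under eq_bigr => u _ do rewrite coordP.
  by rewrite big_split /= -mulr_sumr x1 y1 mulr0 addr0.
- by rewrite !coordP x2 y2.
- have := x3 u; have := y3 u; rewrite !coordP => yu xu.
  by rewrite mulrDr mulrCA xu yu; ring.
Qed.

Lemma coord_relations_rot v x :
  coord_relations x -> coord_relations (op_act T (rot3 v) x).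
Proof.
move=> [x1 x2 x3]; split=> [|u|u]; rewrite ?coord_rot.
- under eq_bigr => u _ do rewrite coord_rot.
  by rewrite -[RHS]x1 [RHS](reindex_inj (@subIr 'I_3 v)).
- by rewrite x2 [RHS]x2.
- by rewrite x3; congr (coord _ _ _ _ - coord _ _ _ _); rewrite addrAC.
Qed.

Lemma coord_relations_swap x :
  coord_relations x -> coord_relations (op_act T swap3 x).
Proof.
move=> [x1 x2 x3]; split=> [|u|u]; rewrite ?coord_swap.
- under eq_bigr => u _ do rewrite coord_swap mul1r.
  by rewrite -[RHS]x1 [RHS](reindex_inj (@oppr_inj 'I_3)).
- by rewrite x2 [in RHS]x2.
- have [-> ->] : - (u + 2%:R) = - u + 1 /\ - (u + 1) = - u + 2%:R.
    by have [->|->|->] := ord3_cases u; split; apply: val_inj.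
  by rewrite expr0 mul1r expr1 x3; ring.
Qed.

Lemma coord_relations_act (s : 'S_3) x :
  coord_relations x -> coord_relations (op_act T s x).
Proof.
have [u [->|->]] := perm3_cases s => Cx; first exact: coord_relations_rot.
by rewrite -op_actM; apply/coord_relations_rot/coord_relations_swap.
Qed.

Lemma tp_relations_coord x : tp_relations x -> coord_relations x.
Proof.
apply=> [|a y z|s y|y].
- split=> [|u|u]; rewrite ?coord0 ?mulr0 ?subr0 //.
  by rewrite big1 // => u _; rewrite coord0.
- exact: coord_relationsP.
- exact: coord_relations_act.
case=> ->; rewrite ?tp_assocE ?tp_jacobiE ?tp_compatE; split=> [|u|u];
  rewrite ?big_ord_recl ?big_ord0 ?big_mkord /= ?(coordD, coordN, coordZ, coord0) /=
    ?coord_basis /GRing.scale /= ?(mulr0, mul0r, addr0, oppr0);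
  try (have [->|->|->] := ord3_cases u); rewrite ?mulr1 //=; try ring.
Qed.

Lemma tp_relations_act (s : 'S_3) x : tp_relations x -> tp_relations (op_act T s x).
Proof. by move=> Rx M M0 MP MA MG; apply: (MA); apply: Rx. Qed.

Lemma tp_relations_assoc : tp_relations (tp_assoc K).
Proof. by move=> M M0 MP MA MG; apply: MG; apply: Or31. Qed.
Lemma tp_relations_jacobi : tp_relations (tp_jacobi K).
Proof. by move=> M M0 MP MA MG; apply: MG; apply: Or32. Qed.
Lemma tp_relations_compat : tp_relations (tp_compat K).
Proof. by move=> M M0 MP MA MG; apply: MG; apply: Or33. Qed.

Lemma tp_relationsP k x y : tp_relations x -> tp_relations y -> tp_relations (k *: x + y).
Proof. by move=> Rx Ry M M0 MP MA MG; apply: (MP); [apply: Rx|apply: Ry]. Qed.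

(** Division by 2 recovers the coefficients of the rotated compatibility relations
    from the coefficients of the composites mu o_u nu. *)
Lemma tp_relations_of_coord x : (2%:R : K) != 0 -> coord_relations x -> tp_relations x.
Proof.
move=> K2 [x1 x2 x3].
have -> : x =
    coord false false 0 x *: tp_assoc K +
    ((coord false false 0 x + coord false false 1 x) *: op_act T (rot3 1) (tp_assoc K) +
    (coord true true 0 x *: tp_jacobi K +
    ((coord false true 1 x / 2%:R) *: tp_compat K +
    ((coord false true 2%:R x / 2%:R) *: op_act T (rot3 1) (tp_compat K) +
    ((coord false true 0 x / 2%:R) *: op_act T (rot3 2%:R) (tp_compat K) + 0))))); last first.
  have R0 : tp_relations (0 : T 3%N) by move=> M M0.
  have [RA RJ RC] := And3 tp_relations_assoc tp_relations_jacobi tp_relations_compat.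
  by do !apply: tp_relationsP => //; apply: tp_relations_act.
apply: coord_inj => i j u.
have x1' : coord false false 2%:R x = - coord false false 0 x - coord false false 1 x.
  move: x1; rewrite !big_ord_recl big_ord0 => x1.
  have [-> -> ->] : [/\ 0 = ord0 :> 'I_3, 1 = lift ord0 ord0 :> 'I_3 &
      2%:R = lift ord0 (lift ord0 ord0) :> 'I_3] by split; apply: val_inj.
  by apply: (addrI (coord false false ord0 x + coord false false (lift ord0 ord0) x));
    move: x1; rewrite addr0 addrA => ->; ring.
have x3' v : coord true false v x =
    (coord false true (v + 2%:R) x - coord false true (v + 1) x) / 2%:R.
  by apply: (mulfI K2); rewrite x3; field.
rewrite tp_assocE tp_jacobiE tp_compatE !big_ord_recl big_ord0.
rewrite !(coordD, coordN, coordZ, coord_rot, coord_basis, coord0).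
case: i; case: j; rewrite ?x3' ?x2; have [->|->|->] := ord3_cases u; rewrite ?x1' /=.
all: try have [-> ->] : 0 + 2%:R = 2%:R :> 'I_3 /\ 0 + 1 = 1 :> 'I_3 by split; apply: val_inj.
all: try have [-> ->] : 1 + 2%:R = 0 :> 'I_3 /\ 1 + 1 = 2%:R :> 'I_3 by split; apply: val_inj.
all: try have [-> ->] : 2%:R + 2%:R = 1 :> 'I_3 /\ 2%:R + 1 = 0 :> 'I_3 by split; apply: val_inj.
all: by field.
Qed.

Lemma coord_relations_iff x : (2%:R : K) != 0 -> tp_relations x <-> coord_relations x.
Proof. by move=> K2; split; [apply: tp_relations_coord|apply: tp_relations_of_coord]. Qed.

Lemma tp_basis_rot u v i j : op_act T (rot3 v) (tp_basis K u i j) = tp_basis K (u + v) i j.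
Proof. exact: op_act_rot. Qed.

(** The bilinear form that pairs e_i o_u e_j with the composite where mu and nu are
    exchanged. *)
Definition coord_form x y : K :=
  \sum_u \sum_i \sum_j coord i j u x * coord (~~ i) (~~ j) u y.

Lemma coord_form_linearl y : linear (fun x => coord_form x y : K^o).
Proof.
move=> k x x'; rewrite /coord_form scaler_sumr -big_split; apply: eq_bigr => u _ /=.
rewrite scaler_sumr -big_split; apply: eq_bigr => i _ /=.
rewrite scaler_sumr -big_split; apply: eq_bigr => j _ /=.
by rewrite coordP mulrDl -mulrA.
Qed.

Lemma coord_form_sym x y : coord_form x y = coord_form y x.
Proof.
apply: eq_bigr => u _; rewrite !big_bool /=; ring.
Qed.

Lemma coord_form_linearr x : linear (fun y => coord_form x y : K^o).
Proof. by move=> k y y'; rewrite !(coord_form_sym x) coord_form_linearl. Qed.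

HB.instance Definition _ x := GRing.isLinear.Build K (T 3%N) K^o *:%R
  (coord_form x : T 3%N -> K^o) (coord_form_linearr x).

Lemma coord_formD x y z : coord_form x (y + z) = coord_form x y + coord_form x z.
Proof. exact: (linearD (coord_form x)). Qed.
Lemma coord_formN x y : coord_form x (- y) = - coord_form x y.
Proof. exact: (linearN (coord_form x)). Qed.
Lemma coord_formZ x k y : coord_form x (k *: y) = k * coord_form x y.
Proof. exact: (linearZ_LR (coord_form x)). Qed.
Lemma coord_form_sum x (F : 'I_3 -> T 3%N) :
  coord_form x (\sum_u F u) = \sum_u coord_form x (F u).
Proof. exact: (linear_sum (coord_form x)). Qed.

Lemma coord_form_basis x v k l : coord_form x (tp_basis K v k l) = coord (~~ k) (~~ l) v x.
Proof.
rewrite /coord_form (bigD1 v) //= [X in _ + X]big1 => [|u uv].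
  rewrite !big_bool !coord_basis eqxx.
  by case: k; case: l; rewrite /=; ring.
have vu : (v == u) = false by rewrite eq_sym (negPf uv).
by rewrite !big_bool !coord_basis vu /=; ring.
Qed.

(** The relations are their own orthogonal. *)
Lemma coord_form_orthogonal x : (2%:R : K) != 0 ->
  (forall y, tp_relations y -> coord_form x y = 0) <-> coord_relations x.
Proof.
move=> K2; split=> [xR|[x1 x2 x3] y /(tp_relations_coord) [y1 y2 y3]].
  split=> [|u|u].
  - have := xR _ tp_relations_jacobi; rewrite tp_jacobiE coord_form_sum => RJ0.
    by rewrite -[RHS]RJ0; apply: eq_bigr => u _; rewrite coord_form_basis.
  - have step v : coord true true v x = coord true true (v + 1) x.
      have := xR _ (tp_relations_act (rot3 v) tp_relations_assoc).
      rewrite tp_assocE op_actD op_actN !tp_basis_rot coord_formD coord_formN !coord_form_basis.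
      by rewrite add0r [1 + v]addrC => /subr0_eq.
    have [->|->|->] := ord3_cases u => //; rewrite [RHS]step ?add0r //.
  - have := xR _ (tp_relations_act (rot3 (u - 1)) tp_relations_compat).
    rewrite tp_compatE !op_actD op_actN op_actZ !tp_basis_rot.
    rewrite !(coord_formD, coord_formN, coord_formZ) !coord_form_basis /= => H.
    have e1 : 1 + (u - 1) = u by rewrite addrC subrK.
    have [e2 e3] : 0 + (u - 1) = u + 2%:R /\ 2%:R + (u - 1) = u + 1.
      by have [->|->|->] := ord3_cases u; split; apply: val_inj.
    move: H; rewrite e1 e2 e3 => H.
    by apply/eqP; rewrite -subr_eq0 -{1}H; apply/eqP; ring.
(* Doubling lets the compatibility equations eliminate the coefficients of
   nu o_u mu; what remains cancels after summation over u. *)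
apply: (mulfI K2); rewrite mulr0 /coord_form mulr_sumr.
under eq_bigr => u _.
  rewrite !big_bool /= x2 y2 (_ : 2%:R * _ =
    2%:R * coord true true 0 x * coord false false u y +
    2%:R * coord true true 0 y * coord false false u x +
    (coord false true (u + 2%:R) x - coord false true (u + 1) x) * coord false true u y +
    (coord false true (u + 2%:R) y - coord false true (u + 1) y) * coord false true u x);
    last by rewrite -x3 -y3; ring.
  over.
rewrite !big_split /= -!mulr_sumr x1 y1 !mulr0 !add0r !big_ord_recl !big_ord0 /=.
have [-> -> ->] : [/\ ord0 = 0 :> 'I_3, lift ord0 ord0 = 1 :> 'I_3 &
    lift ord0 (lift ord0 ord0) = 2%:R :> 'I_3] by split; apply: val_inj.
have [-> ->] : 0 + 2%:R = 2%:R :> 'I_3 /\ 0 + 1 = 1 :> 'I_3 by split; apply: val_inj.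
have [-> ->] : 1 + 2%:R = 0 :> 'I_3 /\ 1 + 1 = 2%:R :> 'I_3 by split; apply: val_inj.
have [-> ->] : 2%:R + 2%:R = 1 :> 'I_3 /\ 2%:R + 1 = 0 :> 'I_3 by split; apply: val_inj.
by ring.
Qed.

End RelationCoordinates.

(** * Isomorphisms of operads *)

Section QuotientIsomorphism.
Variable K : fieldType.

Lemma operad_morphism_cancel (P Q : operad K) (F : forall n, P n -> Q n)
    (G : forall n, Q n -> P n) :
  (forall n, cancel (F n) (G n)) -> (forall n, cancel (G n) (F n)) ->
  operad_morphism F -> operad_morphism G.
Proof.
move=> FK GK [Fl F1 Fa Fc]; split=> [n k x y||n s x|m n p e i x y];
  apply: (can_inj (@FK _)); rewrite ?Fl ?F1 ?Fa ?Fc ?GK //.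
Qed.

Lemma operad_morphismB (P Q : operad K) (F : forall n, P n -> Q n) n (x y : P n) :
  operad_morphism F -> F n (x - y) = F n x - F n y.
Proof. by case=> Fl _ _ _; rewrite addrC -scaleN1r Fl scaleN1r addrC. Qed.

Lemma op_type_morphism (P Q : operad K) (F : forall n, P n -> Q n) u (a b : P 2%N) :
  operad_morphism F -> F 3%N (op_type u a b) = op_type u (F 2%N a) (F 2%N b).
Proof. by case=> _ _ Fa Fc; rewrite /op_type Fa Fc. Qed.

Lemma ideal_gen_morphism (P Q : operad K) (F : forall n, P n -> Q n)
    (R : P 3%N -> Prop) (R' : Q 3%N -> Prop) n (x : P n) :
  operad_morphism F -> (forall y, R y -> R' (F 3%N y)) ->
  ideal_gen R x -> ideal_gen R' (F n x).
Proof.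
move=> Fm RF Rx I idI RI; have [Fl F1 Fa Fc] := Fm.
apply: (Rx (fun n x => I n (F n x))) => [|y /RF]; last exact: RI.
split=> [m|m k y z|m s y|m l p e i y z|m l p e i y z].
- by have := operad_morphismB (0 : P m) 0 Fm; rewrite !subrr => ->; apply: oi0.
- by rewrite Fl; apply: oiP.
- by rewrite Fa; apply: oi_act.
- by rewrite Fc; apply: oi_compl.
- by rewrite Fc; apply: oi_compr.
Qed.

Lemma quadratic_quotient_iso (P Q : operad K) (F : forall n, P n -> Q n)
    (G : forall n, Q n -> P n) (R : P 3%N -> Prop) (R' : Q 3%N -> Prop) :
  (forall n, cancel (F n) (G n)) -> (forall n, cancel (G n) (F n)) ->
  operad_morphism F -> (forall x, R x <-> R' (F 3%N x)) ->
  operad_isomorphic (quot_operad (ideal_gen_ideal R)) (quot_operad (ideal_gen_ideal R')).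
Proof.
move=> FK GK Fm RR'; have Gm := operad_morphism_cancel FK GK Fm.
set idR := ideal_gen_ideal R; set idR' := ideal_gen_ideal R'.
have RF y : R y -> R' (F 3%N y) by move/RR'.
have RG y : R' y -> R (G 3%N y) by move=> R'y; apply/RR'; rewrite GK.
(* The induced maps, defined on representatives; [fE] and [gE] say that the choice
   of representatives does not matter. *)
pose f n (u : quot_sort idR n) : quot_sort idR' n := quot_pi idR' (F n (quot_repr u)).
pose g n (u : quot_sort idR' n) : quot_sort idR n := quot_pi idR (G n (quot_repr u)).
have fE n x : f n (quot_pi idR x) = quot_pi idR' (F n x).
  apply/quot_piP; rewrite -operad_morphismB //; apply: ideal_gen_morphism Fm RF _.
  exact: quot_reprP.
have gE n x : g n (quot_pi idR' x) = quot_pi idR (G n x).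
  apply/quot_piP; rewrite -operad_morphismB //; apply: ideal_gen_morphism Gm RG _.
  exact: quot_reprP.
have [Fl F1 Fa Fc] := Fm.
exists f; split.
  split=> [n k||n s|m n p e i].
  - elim/quot_piW=> x; elim/quot_piW=> y.
    by rewrite quot_piZ quot_piD !fE quot_piZ quot_piD Fl.
  - by rewrite [LHS]fE F1.
  - by elim/quot_piW=> x; rewrite [op_act _ _ _]quot_actE !fE Fa [RHS]quot_actE.
  - elim/quot_piW=> x; elim/quot_piW=> y.
    by rewrite [op_comp _ _ _ _ _]quot_compE !fE Fc [RHS]quot_compE.
move=> n; exists (g n).
- by elim/quot_piW=> x; rewrite fE gE FK.
- by elim/quot_piW=> x; rewrite gE fE GK.
Qed.

Lemma free_operad_functor (E E' : binary_module K) (h : E -> E') :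
  linear h -> (forall s x, h (bm_act E s x) = bm_act E' s (h x)) ->
  exists2 F : forall n, free_operad E n -> free_operad E' n,
    operad_morphism F & forall x, F 2%N (free_gen x) = free_gen (h x).
Proof.
move=> hl ha; have [] // := @free_operad_universal K E (free_operad E') (@free_gen K E' \o h).
by split=> [k x y|s x] /=; rewrite ?hl ?ha ?free_gen_linear ?free_gen_act.
Qed.

Lemma operad_morphism_comp (P Q S : operad K) (F : forall n, P n -> Q n)
    (G : forall n, Q n -> S n) :
  operad_morphism F -> operad_morphism G -> operad_morphism (fun n => G n \o F n).
Proof.
move=> [Fl F1 Fa Fc] [Gl G1 Ga Gc].
by split=> [n k x y||n s x|m n p e i x y]; rewrite /= ?Fl ?Gl ?F1 ?G1 ?Fa ?Ga ?Fc ?Gc.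
Qed.

Lemma operad_morphism_id (P : operad K) : operad_morphism (fun n (x : P n) => x).
Proof. by split. Qed.

Lemma free_operad_endo_id (E : binary_module K)
    (F : forall n, free_operad E n -> free_operad E n) :
  operad_morphism F -> (forall a, F 2%N (free_gen a) = free_gen a) ->
  forall n, F n =1 id.
Proof.
move=> Fm Fg n x.
have id_eq : equivariant (@free_gen K E) by exact: free_gen_equivariant.
have [_ uniq] := free_operad_universal id_eq.
exact: (uniq F (fun n x => x) Fm (@operad_morphism_id (free_operad E)) Fg).
Qed.

End QuotientIsomorphism.

(** * Self-duality *)

Section SelfDuality.
Variable K : fieldType.
Let E := tp_module K.
Let E' := dual_module E.
Implicit Types (a b : E) (f g : E') (u v : 'I_3).

(** The bilinear form on E whose matrix in the basis (mu, nu) is the exchange. *)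
Definition swap_form a b : K :=
  tp_coef false a * tp_coef true b + tp_coef true a * tp_coef false b.

Lemma swap_form_linear a : linear (fun b => swap_form a b : K^o).
Proof. by move=> k b c; rewrite /swap_form !tp_coefP /GRing.scale /=; ring. Qed.
HB.instance Definition _ a := GRing.isLinear.Build K E K^o *:%R
  (swap_form a : E -> K^o) (swap_form_linear a).

(** The isomorphism mu |-> nu*, nu |-> mu* and its inverse. *)
Definition to_dual a : E' := linfun (swap_form a : E -> K^o).
Definition of_dual f : E := ((f : 'Hom(E, K^o)) (tp_nu K), (f : 'Hom(E, K^o)) (tp_mu K)).

Lemma to_dualE a b : (to_dual a : 'Hom(E, K^o)) b = swap_form a b.
Proof. by rewrite lfunE. Qed.

Lemma to_dual_linear : linear to_dual.
Proof.
move=> k a b; apply/lfunP => c; rewrite add_lfunE scale_lfunE !to_dualE.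
by rewrite /swap_form !tp_coefP /GRing.scale /=; ring.
Qed.

Lemma to_dualK : cancel to_dual of_dual.
Proof.
case=> a1 a2; rewrite /of_dual !to_dualE /swap_form /=.
by congr (_, _); ring.
Qed.

Lemma swap_form_of_dual f b : swap_form (of_dual f) b = (f : 'Hom(E, K^o)) b.
Proof.
rewrite {2}[b]tp_genE linearD !linearZ /swap_form /of_dual /= /GRing.scale /=.
by rewrite /tp_coef; ring.
Qed.

Lemma of_dualK : cancel of_dual to_dual.
Proof. by move=> f; apply/lfunP => b; rewrite to_dualE swap_form_of_dual. Qed.

Lemma of_dual_linear : linear of_dual.
Proof.
by move=> k f g; apply: (can_inj to_dualK); rewrite to_dual_linear !of_dualK.
Qed.

Lemma to_dual_act s a : to_dual (bm_act E s a) = bm_act E' s (to_dual a).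
Proof.
apply/lfunP => b; rewrite to_dualE [bm_act E' s _]lfunE /= /dual_act_fun.
rewrite scale_lfunE comp_lfunE to_dualE.
rewrite /swap_form !tp_coef_act odd_permV /GRing.scale /=.
by case: (odd_perm s); rewrite /= ?expr0 ?expr1; ring.
Qed.

Lemma of_dual_act s f : of_dual (bm_act E' s f) = bm_act E s (of_dual f).
Proof. by apply: (can_inj to_dualK); rewrite to_dual_act !of_dualK. Qed.

Lemma free_dual_iso : exists F : forall n, free_operad E n -> free_operad E' n,
  exists G : forall n, free_operad E' n -> free_operad E n,
  [/\ operad_morphism F, operad_morphism G &
      [/\ forall n, cancel (F n) (G n), forall n, cancel (G n) (F n) &
         forall f, G 2%N (free_gen f) = free_gen (of_dual f)]].
Proof.
have [F Fm Fg] := free_operad_functor to_dual_linear to_dual_act.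
have [G Gm Gg] := free_operad_functor of_dual_linear of_dual_act.
exists F, G; split=> //; split=> // n.
  apply: (free_operad_endo_id (operad_morphism_comp Fm Gm)) => a /=.
  by rewrite Fg Gg to_dualK.
apply: (free_operad_endo_id (operad_morphism_comp Gm Fm)) => f /=.
by rewrite Gg Fg of_dualK.
Qed.

Lemma coord_form_op_type u v a a' b b' :
  coord_form (op_type u (free_gen a) (free_gen a')) (op_type v (free_gen b) (free_gen b'))
  = (u == v)%:R * swap_form a b * swap_form a' b'.
Proof.
rewrite /coord_form (bigD1 u) //= [X in _ + X]big1 => [|w wu].
  rewrite !big_bool /= !coord_op_type eqxx /swap_form [v == u]eq_sym.
  by case: (u == v); rewrite /=; ring.
have uw : (u == w) = false by rewrite eq_sym (negPf wu).
by rewrite !big_bool /= !coord_op_type uw /=; ring.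
Qed.

(** Existence and uniqueness of the natural pairing: transported along the
    isomorphism of free operads, it is the form [coord_form]. *)
Lemma natural_pairing_coord_form (G : forall n, free_operad E' n -> free_operad E n)
    (B : free_operad E' 3%N -> free_operad E 3%N -> K) :
  operad_morphism G -> (forall f, G 2%N (free_gen f) = free_gen (of_dual f)) ->
  natural_pairing B <-> (forall y x, B y x = coord_form (G 3%N y) x).
Proof.
move=> Gm Gg; have [Gl _ _ _] := Gm; split=> [[Bl Br Bg] y x|BE]; last first.
  split=> [x k y z|y k x z|u v f g a b]; rewrite !BE.
  - by rewrite Gl coord_form_linearl.
  - by rewrite coord_form_linearr.
  - by rewrite op_type_morphism // !Gg coord_form_op_type !swap_form_of_dual.
have B0l x' : B 0 x' = 0 by have := Bl x' (-1) 0 0; rewrite !scaleN1r !addNr.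
have B0r y' : B y' 0 = 0 by have := Br y' (-1) 0 0; rewrite !scaleN1r !addNr.
have G0 : G 3%N 0 = 0 by have := operad_morphismB (0 : free_operad E' 3%N) 0 Gm; rewrite !subrr.
move: y; apply: free_arity3_ind => [|k y z Hy Hz|u f g].
- by rewrite B0l G0 coord_form_sym; exact: esym (linear0 (coord_form x)).
- by rewrite Bl Gl coord_form_linearl Hy Hz.
move: x; apply: free_arity3_ind => [|k y z Hy Hz|v a b].
- by rewrite B0r; exact: esym (linear0 (coord_form _)).
- by rewrite Br coord_form_linearr Hy Hz.
by rewrite Bg op_type_morphism // !Gg coord_form_op_type !swap_form_of_dual.
Qed.

Lemma orthogonal_tp_relations (G : forall n, free_operad E' n -> free_operad E n) y :
  (2%:R : K) != 0 -> operad_morphism G ->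
  (forall f, G 2%N (free_gen f) = free_gen (of_dual f)) ->
  Defs.orthogonal (@tp_relations K) y <-> tp_relations (G 3%N y).
Proof.
move=> K2 Gm Gg; rewrite coord_relations_iff // -coord_form_orthogonal //.
have pairingE B := @natural_pairing_coord_form G B Gm Gg.
split=> [[B /pairingE BE Bx] x Rx|Cx]; first by rewrite -BE Bx.
by exists (fun y x => coord_form (G 3%N y) x) => //; apply/pairingE.
Qed.

End SelfDuality.

Theorem proposition2p10 (K : fieldType) (charK : [pchar K]%R =i pred0) :
  operad_isomorphic (tp_operad K) (koszul_dual (@tp_relations K)).
Proof.
have K2 : (2%:R : K) != 0.
  by apply/negP => K2; have := charK 2%N; rewrite !inE K2.
have [F [G [Fm Gm [FK GK Gg]]]] := free_dual_iso K.
apply: (quadratic_quotient_iso FK GK Fm) => x.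
by rewrite (orthogonal_tp_relations (F 3%N x) K2 Gm Gg) FK.
Qed.
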